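(* Let $T: C^\infty(X,E)\to C^\infty(Y,F)$ be a separating, nowhere trivial linear operator which maps some (nonempty) open set in $C^\infty(X,E)$ onto a bounded set in $C^\infty(Y,F)$. Then there is a partition of $Y$ into clopen subsets $(Y_\alpha)$ so that the support map of $T$ is constant on each $Y_\alpha$.
   Context: $G,H,E,F$ are real Banach spaces; $X\subseteq G$ and $Y\subseteq H$ are open. $\mathcal{S}^k(G,E)$ is the Banach space of bounded symmetric $k$-linear maps $G^k\to E$, with $\mathcal{S}^0(G,E)=E$. $C^\infty(X,E)$ is the space of all $f:X\to E$ such that for all integers $k\ge0$ the Fréchet derivative $D^kf$ ($D^0f=f$) is a continuous function from $X$ to $\mathcal{S}^k(G,E)$; $C^\infty(X)=C^\infty(X,\mathbb{R})$. $C^\infty(X,E)$ carries the topology generated by the seminorms $\rho_{K,k}(f)=\sup_{x\in K}\sup_{0\le j\le k}\|D^jf(x)\|$, $K\subseteq X$ compact, $k\ge0$; similarly for $C^\infty(Y,F)$. A set is bounded if it is absorbed by every open neighborhood of $0$, equivalently, if each of these seminorms is bounded on it. Standing assumption: there is a bump function $\varphi\in C^\infty(G,\mathbb{R})$ with $\varphi(x)=1$ if $\|x\|\le 1/2$, $\varphi(x)=0$ if $\|x\|\ge1$, and $\sup_{x\in G}\|D^k\varphi(x)\|<\infty$ for all $k\ge0$. Two functions are disjoint if at every point at least one of them is $0$. A map $T$ is separating if it maps disjoint functions to disjoint functions. $T$ is nowhere trivial if for every $y\in Y$ there is $f\in C^\infty(X,E)$ with $Tf(y)\ne0$. Support map: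 let $\mathbb{R}_\infty$ be the one-point compactification of $\mathbb{R}$, $i:X\to\mathbb{R}_\infty^{C^\infty(X)}$, $i(x)(\psi)=\psi(x)$ (a homeomorphic embedding), and let $\mathcal{A}X$ be the closure of $i(X)$. For $f\in C^\infty(X,E)$ let $\overline{C}(f)$ be the closure in $\mathcal{A}X$ of $i(\{x:f(x)\ne0\})$. For $y\in Y$ let $\mathcal{O}_y$ be the family of open subsets $U$ of $\mathcal{A}X$ for which there is $f\in C^\infty(X,E)$ with $Tf(y)\ne0$ and $\overline{C}(f)\subseteq U$. Then $h(y)$ is the unique point of $\bigcap\{\overline{U}^{\mathcal{A}X}:U\in\mathcal{O}_y\}$; for $T$ continuous, separating and nowhere trivial, $h(y)\in i(X)$, and $i(X)$ is identified with $X$, so that the support map is a (continuous) map $h:Y\to X$. *)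

(* Defs.v *)
From HB Require Import structures.
From mathcomp Require Import all_boot all_order all_algebra all_fingroup.
From mathcomp Require Import all_classical all_reals all_analysis.

Set Implicit Arguments.
Unset Strict Implicit.
Unset Printing Implicit Defensive.
Import Order.TTheory GRing.Theory Num.Theory.
Import numFieldNormedType.Exports.
Local Open Scope classical_set_scope.
Local Open Scope ring_scope.

Definition upd (k : nat) (T : Type) (w : 'I_k -> T) (i : 'I_k) (v : T) :
  'I_k -> T := fun j => if j == i then v else w j.

Section symml_def.
Context {R : realType} (k : nat) (G E : normedModType R).
Implicit Types A B : ('I_k -> G) -> E.

Definition multilinear A :=
  forall w i a u v,
    A (upd w i (a *: u + v)) = a *: A (upd w i u) + A (upd w i v).

Definition symmetric_map A := forall (s : {perm 'I_k}) w, A (w \o s) = A w.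

Definition bounded_map A :=
  exists M : R, forall w, `|A w| <= M * \prod_(i < k) `|w i|.

Definition symml_pred : {pred ('I_k -> G) -> E} :=
  fun A => `[< [/\ multilinear A, symmetric_map A & bounded_map A] >].

Record symml := Symml { symml_val :> ('I_k -> G) -> E;
                        symml_valP : symml_val \in symml_pred }.

HB.instance Definition _ := [isSub for symml_val].
HB.instance Definition _ := [Choice of symml by <:].

Lemma symml_submod_closed : submod_closed symml_pred.
Proof.
split=> [|c A B /asboolP[mA sA [M bA]] /asboolP[mB sB [N bB]]]; apply/asboolP.
  split=> [w i a u v|s w|]; rewrite ?scaler0 ?addr0//.
  by exists 0 => w; rewrite mul0r normr0.
split=> [w i a u v|s w|].
- rewrite !fctE/= mA mB !scalerDr !scalerA (mulrC a c) -!addrA; congr (_ + _).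
  by rewrite addrCA.
- by rewrite !fctE/= sA sB.
- exists (`|c| * M + N) => w; rewrite !fctE/= mulrDl -mulrA.
  by rewrite (le_trans (ler_normD _ _))// normrZ lerD// ler_wpM2l.
Qed.

HB.instance Definition _ :=
  GRing.isSubmodClosed.Build _ _ symml_pred symml_submod_closed.
HB.instance Definition _ := [SubChoice_isSubLmodule of symml by <:].

End symml_def.

Section symml_norm.
Context {R : realType} {k : nat} {G E : normedModType R}.
Implicit Types A B : symml k G E.

Lemma symmlP A : [/\ multilinear A, symmetric_map A & bounded_map A].
Proof. exact/asboolP/symml_valP. Qed.

Lemma symml_eqP A B : (forall w, A w = B w) -> A = B.
Proof. by move=> AB; apply/val_inj/funext. Qed.

Lemma symmlZDE c A B w : (c *: A + B) w = c *: A w + B w.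
Proof. by []. Qed.

Definition unit_tuples : set ('I_k -> G) := [set w | forall i, `|w i| <= 1].

Definition symml_norm A : R := sup [set `|A w| | w in unit_tuples].

Lemma unit_tuples0 : unit_tuples (fun=> 0).
Proof. by move=> i; rewrite normr0. Qed.

Lemma symml_has_sup A : has_sup [set `|A w| | w in unit_tuples].
Proof.
split; first by exists `|A (fun=> 0)|, (fun=> 0) => //; exact: unit_tuples0.
have [_ _ [M bA]] := symmlP A; exists `|M| => _ [w w1 <-].
apply: (le_trans (bA w)); rewrite (le_trans (ler_norm _))// normrM.
rewrite -[leRHS]mulr1 ler_wpM2l// ger0_norm ?prodr_ge0//.
by apply: prodr_ile1 => i _; rewrite normr_ge0 w1.
Qed.

Lemma symml_norm_ub A w : unit_tuples w -> `|A w| <= symml_norm A.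
Proof. by move=> w1; apply: sup_upper_bound; [exact: symml_has_sup|exists w]. Qed.

Lemma symml_norm_le A M :
  (forall w, unit_tuples w -> `|A w| <= M) -> symml_norm A <= M.
Proof.
move=> AM; apply: ge_sup; first by case: (symml_has_sup A).
by move=> _ [w w1 <-]; exact: AM.
Qed.

Lemma symml_norm_ge0 A : 0 <= symml_norm A.
Proof. exact: le_trans (symml_norm_ub A unit_tuples0). Qed.

Lemma multilinearZ A w i a v : A (upd w i (a *: v)) = a *: A (upd w i v).
Proof.
have [mA _ _] := symmlP A.
have A0 : A (upd w i 0) = 0.
  by have := mA w i (-1) 0 0; rewrite scaler0 addr0 scaleN1r addNr.
by rewrite -[a *: v]addr0 mA A0 addr0.
Qed.

Lemma multilinearZs A (c : 'I_k -> R) w :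
  A (fun i => c i *: w i) = (\prod_(i < k) c i) *: A w.
Proof.
suff H (s : seq 'I_k) : uniq s ->
    A (fun i => if i \in s then c i *: w i else w i) =
    (\prod_(i <- s) c i) *: A w.
  rewrite -H; last exact: index_enum_uniq.
  by congr (symml_val A _); apply/funext => i; rewrite mem_index_enum.
elim: s => [_|i s IH /= /andP[is_ us]]; first by rewrite big_nil scale1r.
rewrite big_cons -scalerA -(IH us).
set w' := (fun j => if j \in s then _ else _).
have -> : (fun j => if j \in i :: s then c j *: w j else w j) =
    upd w' i (c i *: w i).
  apply/funext => j; rewrite /upd /w' inE; case: eqP => [->|] //=.
rewrite multilinearZ; congr (_ *: symml_val A _).
by apply/funext => j; rewrite /upd /w'; case: eqP => [->|//]; rewrite (negPf is_).
Qed.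

Lemma symml_normD A B : symml_norm (A + B) <= symml_norm A + symml_norm B.
Proof.
apply: symml_norm_le => w w1.
by rewrite (le_trans (ler_normD _ _))// lerD// symml_norm_ub.
Qed.

Lemma symml_normZ (a : R) A : symml_norm (a *: A) = `|a| * symml_norm A.
Proof.
have le (b : R) B : symml_norm (b *: B) <= `|b| * symml_norm B.
  by apply: symml_norm_le => w w1; rewrite normrZ ler_wpM2l// symml_norm_ub.
apply/eqP; rewrite eq_le le/=; have [->|a0] := eqVneq a 0.
  by rewrite normr0 mul0r symml_norm_ge0.
rewrite -ler_pdivlMl ?normr_gt0// -normfV.
by rewrite -[X in symml_norm X <= _](scalerK a0) le.
Qed.

Lemma symml_norm0_eq0 A : symml_norm A = 0 -> A = 0.
Proof.
move=> A0; apply: symml_eqP => w /=; apply/eqP; rewrite -normr_eq0.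
pose s := \sum_(i < k) `|w i|; have s1 : 0 < 1 + s.
  by rewrite ltr_wpDr// sumr_ge0.
have : `|A (fun i => (1 + s)^-1 *: w i)| <= 0.
  rewrite -A0 symml_norm_ub// => i; rewrite normrZ gtr0_norm ?invr_gt0//.
  rewrite ler_pdivrMl// mulr1 /s (bigD1 i)//= addrCA ler_wpDr//.
  by rewrite addr_ge0// sumr_ge0.
rewrite multilinearZs normr_le0 scaler_eq0 => /orP[|/eqP->]; last by rewrite normr0.
by rewrite prodf_seq_eq0 => /hasP[i _]; rewrite /= invr_eq0 gt_eqF.
Qed.

HB.instance Definition _ := @Lmodule_isNormed.Build R (symml k G E)
  symml_norm symml_normD symml_normZ symml_norm0_eq0.

End symml_norm.

Section symml0.
Context {R : realType} {G E : normedModType R}.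

Lemma symml0_subproof (e : E) : (fun=> e) \in @symml_pred R 0 G E.
Proof.
apply/asboolP; split=> [? []//|//|].
by exists `|e| => w; rewrite big_ord0 mulr1.
Qed.

(* The identification of E with the space of 0-linear maps. *)
Definition symml0 (e : E) : symml 0 G E := Symml (symml0_subproof e).

End symml0.

Section frechet.
Context {R : realType} {G E : normedModType R}.
Implicit Types (f g : G -> E) (X : set G).

Definition frechet_step k (D : G -> symml k G E) (x : G)
    (A : symml k.+1 G E) : Prop :=
  forall w, A w = ('d D x (w ord0) : symml k G E) (fun i => w (lift ord0 i)).

(* The k-th derivative is the differential of the (k-1)-th one, a bounded
   linear map from G to S^(k-1)(G,E), read as a k-linear map.  The default
   value 0 is only taken where this differential is not in S^k(G,E). *)
Fixpoint frechet f (k : nat) : G -> symml k G E :=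
  if k is k'.+1 return G -> symml k G E
  then fun x => xget 0 (frechet_step (frechet f k') x)
  else fun x => symml0 (f x).

(* The clause on [frechet_step] says that the derivative of order k.+1 is
   not the default value. *)
Definition smooth_on X f := forall k x, X x ->
  [/\ differentiable (frechet f k) x,
      frechet_step (frechet f k) x (frechet f k.+1 x) &
      {for x, continuous (frechet f k)}].

Lemma near_eq_is_diff (V W : normedModType R) (f g : V -> W) x :
  (\near x, f x = g x) -> differentiable f x -> is_diff x g ('d f x).
Proof.
move=> fg df; have gx : g x = f x by rewrite (nbhs_singleton fg).
have shx : (fun y => y + x) @ (0 : V) --> x.
  by rewrite -[X in _ --> X]add0r; apply: cvgD; [exact: cvg_id|exact: cvg_cst].
have gE : g \o shift x = cst (g x) + 'd f x +o_ 0 id.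
  apply/eqaddoP => e e0; have /diff_locally/eqaddoP/(_ e e0) := df.
  have fg0 : \forall y \near (0 : V), f (y + x) = g (y + x) by move: fg => /shx.
  apply: filterS2 fg0 => y /= fgy.
  by rewrite gx !fctE /= fgy.
have dgE : 'd g x = 'd f x :> (V -> W)
    by apply: diff_unique gE; exact: diff_continuous.
split=> //; apply/diff_locallyP; split; last by rewrite dgE.
by rewrite dgE; exact: diff_continuous.
Qed.

Lemma frechetP X f (D : forall k, G -> symml k G E) : open X ->
  (forall x, X x -> D 0 x = symml0 (f x)) ->
  (forall k x, X x ->
     differentiable (D k) x /\ frechet_step (D k) x (D k.+1 x)) ->
  smooth_on X f /\ (forall k x, X x -> frechet f k x = D k x).
Proof.
move=> oX D0 DS.
have nearX x (P : G -> Prop) : X x -> (forall y, X y -> P y) -> \near x, P x.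
  by move=> Xx XP; apply: filterS XP _; exact: open_nbhs_nbhs.
have step k : (forall x, X x -> frechet f k x = D k x) -> forall x, X x ->
    is_diff x (frechet f k) ('d (D k) x).
  move=> fD x Xx; apply: near_eq_is_diff; last by have [] := DS k x Xx.
  by apply: nearX => // y Xy; rewrite fD.
have uniq k x A : X x -> is_diff x (frechet f k) ('d (D k) x) ->
    frechet_step (frechet f k) x A <-> A = D k.+1 x.
  move=> Xx dfD; have [_ DSx] := DS k x Xx.
  rewrite /frechet_step diff_val; split=> [H|-> //].
  by apply: symml_eqP => w; rewrite H DSx.
have fD k x : X x -> frechet f k x = D k x.
  elim: k x => [|k IH] x Xx; first by rewrite D0.
  have dfD := step k IH x Xx.
  apply/(uniq k x _ Xx dfD); apply: (@xgetPex _ 0 (frechet_step _ x)).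
  by exists (D k.+1 x); apply/(uniq k x _ Xx dfD).
split=> // k x Xx; have dfD := step k (fD k) x Xx.
split; [exact: ex_diff| |exact: differentiable_continuous ex_diff].
by apply/(uniq k x _ Xx dfD); exact: fD.
Qed.

Lemma smooth_onZD X c f g : open X -> smooth_on X f -> smooth_on X g ->
  smooth_on X (c *: f + g) /\ (forall k x, X x ->
    frechet (c *: f + g) k x = c *: frechet f k x + frechet g k x).
Proof.
move=> oX sf sg.
apply: (@frechetP X (c *: f + g)
  (fun k x => c *: frechet f k x + frechet g k x) oX).
  by move=> x _; apply: symml_eqP.
move=> k x Xx; have [df sfx _] := sf k x Xx; have [dg sgx _] := sg k x Xx.
have := @is_diffD _ _ _ (c *: frechet f k) (frechet g k) _ _ x
  (is_diffZ c (differentiableP df)) (differentiableP dg).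
case=> dD dE; split; first exact: dD.
move=> w; rewrite [RHS](congr1 (fun L => (L (w ord0) : symml k G E) _) dE).
rewrite symmlZDE [LHS](congr2 (fun a b => c *: a + b) (sfx w) (sgx w)).
by rewrite -symmlZDE.
Qed.

Lemma smooth_on0 X : open X ->
  smooth_on X 0 /\ (forall k x, X x -> frechet 0 k x = 0).
Proof.
move=> oX; apply: (@frechetP X 0 (fun k x => 0) oX) => [x _|k x _].
  exact: symml_eqP.
by split; [exact: differentiable_cst|move=> w; rewrite diff_cst].
Qed.

End frechet.

Definition Cinf_pred {R : realType} {G E : normedModType R} (X : set G) :
  {pred G -> E} :=
  fun f => `[< smooth_on X f /\ (forall x, ~ X x -> f x = 0) >].

(* A function on X is represented by its extension by 0 to G, so that equality
   of elements is equality of functions on X.  The proof that X is open is a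
   parameter of the type because the linear structure depends on it. *)
Record Cinf {R : realType} {G : normedModType R} {X : set G} (oX : open X)
    (E : normedModType R) :=
  MkCinf { Cinf_val :> G -> E; Cinf_valP : Cinf_val \in Cinf_pred X }.

Section Cinf_theory.
Context {R : realType} {G : normedModType R} {X : set G} (oX : open X)
  (E : normedModType R).
Local Notation Cinf := (Cinf oX E).

HB.instance Definition _ := [isSub of Cinf for @Cinf_val R G X oX E].
HB.instance Definition _ := [Choice of Cinf by <:].

Lemma Cinf_submod_closed : submod_closed (Cinf_pred X : {pred G -> E}).
Proof.
split=> [|c f g /asboolP[sf f0] /asboolP[sg g0]]; apply/asboolP; split=> //.
- by have [] := @smooth_on0 R G E X oX.
- by have [] := smooth_onZD c oX sf sg.
- by move=> x Xx; rewrite !fctE f0// g0// scaler0 addr0.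
Qed.

HB.instance Definition _ :=
  GRing.isSubmodClosed.Build _ _ (Cinf_pred X : {pred G -> E}) Cinf_submod_closed.
HB.instance Definition _ := [SubChoice_isSubLmodule of Cinf by <:].

Definition Dn (k : nat) (f : Cinf) : G -> symml k G E := frechet f k.

Definition rho (K : set G) (k : nat) (f : Cinf) : R :=
  sup [set `|Dn p.1 f p.2| | p in [set p : nat * G | (p.1 <= k)%N /\ K p.2]].

Definition rho_ball (f : Cinf) (K : set G) (k : nat) (e : R) : set Cinf :=
  [set g | rho K k (g - f) < e].

Definition rho_balls : set (set Cinf) :=
  [set B | exists f K k e, [/\ compact K, K `<=` X, 0 < e & B = rho_ball f K k e]].

HB.instance Definition _ :=
  isSubBaseTopological.Build Cinf rho_balls (id : set Cinf -> set Cinf).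

Definition disjoint_funs (f g : Cinf) := forall x, X x -> f x = 0 \/ g x = 0.

End Cinf_theory.

Definition absorbed_by (R : realType) (V : lmodType R) (A U : set V) :=
  exists2 s : R, 0 < s & forall t, s < t -> A `<=` [set t *: u | u in U].

Definition tvs_bounded (R : realType) (V : preTopologicalLmodType R) (A : set V) :=
  forall U : set V, open U -> U 0 -> absorbed_by A U.

Definition has_bump (R : realType) (G : normedModType R) :=
  exists phi : Cinf (@openT G) R^o,
    [/\ forall x, `|x| <= 2^-1 -> phi x = 1,
        forall x, 1 <= `|x| -> phi x = 0 &
        forall k, exists M : R, forall x, `|Dn k phi x| <= M].

Section support_map.
Context {R : realType} {G H E F : normedModType R} {X : set G} {Y : set H}
  (oX : open X) (oY : open Y).
Variable T : Cinf oX E -> Cinf oY F.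

Definition separating := forall f g, disjoint_funs f g ->
  disjoint_funs (T f) (T g).

Definition nowhere_trivial := forall y, Y y -> exists f, T f y <> 0.

Definition Rinf_pow := {ptws Cinf oX R^o -> one_point_compactification R}.

Definition eval_embedding (x : G) : Rinf_pow := fun psi => Some (psi x : R).

Definition compactification : set Rinf_pow := closure (eval_embedding @` X).

(* As [compactification] is closed, closures in it are closures in Rinf_pow. *)
Definition closed_carrier (f : Cinf oX E) : set Rinf_pow :=
  closure (eval_embedding @` [set x | X x /\ f x <> 0]).

Definition support_opens (y : H) : set (set Rinf_pow) :=
  [set U | (exists2 V, open V & U = V `&` compactification) /\
           exists2 f : Cinf oX E, T f y <> 0 & closed_carrier f `<=` U].

(* X is identified with its image under [eval_embedding].  The default value 0
   is only taken where the intersection is not a single point of that image,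
   which does not happen for T continuous, separating and nowhere trivial when
   G has a bump function. *)
Definition support_map (y : H) : G :=
  xget 0 [set x | X x /\
    \bigcap_(U in support_opens y) closure U = [set eval_embedding x]].

End support_map.

(* Main.v *)
Require Import Defs.
From HB Require Import structures.
From mathcomp Require Import all_boot all_order all_algebra all_fingroup.
From mathcomp Require Import finmap.
From mathcomp Require Import all_classical all_reals all_analysis.
From mathcomp Require Import ring lra.
Set Implicit Arguments.
Unset Strict Implicit.
Unset Printing Implicit Defensive.
Import Order.TTheory GRing.Theory Num.Theory.
Import numFieldNormedType.Exports.
Local Open Scope classical_set_scope.
Local Open Scope ring_scope.

(** Why the support map is locally constant.  A neighbourhood in C^infty(X,E)
constrains only finitely many derivatives, say those of order at most k on a
compact set K, whereas a bounded set of C^infty(Y,F) has bounded derivatives of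
every order.  An operator T that maps an open set onto a bounded set therefore
satisfies, with one and the same pair (K, k), an estimate

   |D^m (T f)| <= C * sup over K of |f|, |D f|, ..., |D^k f|    on L

for every compact subset L of Y and every m ([bounded_open_estimate]): T gains
arbitrarily many derivatives.

Call x a support point of y if every neighbourhood of x carries a function f
with T f y <> 0.  Because T is separating, T g vanishes near y as soon as g
vanishes near a support point of y ([supported_vanish]).  Covering K by finitely
many balls and cutting functions off with bumps on them shows that each y has a
support point in K ([supported_exists]), and the construction by
compactification finds no other point ([support_opens_bigcap]).

Now let x and x' be support points in K of two points y_s and y_t of a segment
in Y, let d = |x - x'|, and let f be such that |T f| >= c > 0 on the segment.
Multiply f by a bump of width d/2 around x'.  The product g equals f near x',
so T g = T f at y_t; it vanishes near x, so T g has a zero of infinite order at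
y_s; and its derivatives of order at most n = k + 1 are O(d^-n).  The estimate
with m = 2n and Taylor's inequality from y_s to y_t give

   c <= |T g y_t| <= C' * d^-n * |s - t|^(2n),

that is d <= B * |s - t|^2 ([support_square_increment]).  A path whose
increments are quadratic in the parameter has derivative zero, so the support
point is constant on the segment ([square_increment_const]); small balls of Y
being convex, the support map is locally constant, and its fibres are the
required clopen sets.

Bump functions act on E-valued functions through Leibniz' formula for
derivatives of all orders.  To keep this formula free of sums over index
sets, a k-linear map is read as a function on lists of k vectors: a sequence of
derivatives is a single function of a point and a list, differentiating prepends
a vector to the list, and Leibniz' formula becomes the two-line recursion
[leibniz]. *)

(** * Multilinear maps as functions on lists *)

Section list_forms.
Context {R : realType} {G E : normedModType R}.
Implicit Types (a : seq G -> E) (s t : seq G).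

Definition norm_prod s : R := \prod_(v <- s) `|v|.

Lemma norm_prod_ge0 s : 0 <= norm_prod s.
Proof. by rewrite /norm_prod prodr_ge0. Qed.

Lemma norm_prod_cons v s : norm_prod (v :: s) = `|v| * norm_prod s.
Proof. by rewrite /norm_prod big_cons. Qed.

(** Bounds are asked for all lengths up to [k] at once: the recursion of Leibniz'
formula distributes a list over two shorter ones. *)
Definition bounded_upto (k : nat) (M : R) a :=
  forall s, (size s <= k)%N -> `|a s| <= M * norm_prod s.

Definition list_linear a := forall s c u v t,
  a (s ++ (c *: u + v) :: t) = c *: a (s ++ u :: t) + a (s ++ v :: t).

(** Adjacent transpositions suffice for symmetry ([list_swap_perm]), and unlike
general permutations they are stable under prepending a vector. *)
Definition list_swap a := forall s u v t,
  a (s ++ u :: v :: t) = a (s ++ v :: u :: t).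

Definition list_form a :=
  [/\ list_linear a, list_swap a & forall k, exists M, bounded_upto k M a].

Lemma list_swap_perm a s t : list_swap a -> perm_eq s t -> a s = a t.
Proof.
move=> swa; suff H p : perm_eq s t -> a (p ++ s) = a (p ++ t) by exact: (H [::]).
elim: s t p => [|u s IH] t p st.
  by rewrite perm_sym in st; move/perm_nilP: st => ->.
have : u \in t by rewrite -(perm_mem st) mem_head.
move=> ut; move: st; case/splitPr: ut => t1 t2.
rewrite perm_sym perm_catC /= perm_cons perm_sym => st.
have {IH} -> : a (p ++ u :: s) = a (p ++ u :: (t1 ++ t2)).
  rewrite -cat_rcons (IH (t1 ++ t2)) ?cat_rcons//.
  by apply: (perm_trans st); rewrite perm_catC.
elim: t1 p {st} => [//|v t1 IH] p /=.
by rewrite swa -!(cat_rcons v) IH.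
Qed.

(** Replacing one argument of a tuple is replacing one entry, at a fixed place,
of the list of its values. *)
Lemma codom_upd k (w : 'I_k -> G) i : exists s t, forall u,
  codom (upd w i u) = s ++ u :: t.
Proof.
have := mem_enum predT i; rewrite inE => ien.
have := enum_uniq 'I_k; rewrite /codom /image_mem.
case/splitPr: (ien : i \in enum 'I_k) => s t.
rewrite cat_uniq /= => /and3P[_ /norP[is_ _] /andP[it _]].
exists (map w s), (map w t) => u; rewrite map_cat /= {2}/upd eqxx.
by congr (_ ++ _ :: _); apply/eq_in_map => j jt; rewrite /upd;
  case: eqP => // ji; rewrite -ji jt in is_ it *.
Qed.

Lemma norm_prod_codom k (w : 'I_k -> G) :
  norm_prod (codom w) = \prod_(i < k) `|w i|.
Proof. by rewrite /norm_prod /codom /image_mem big_map big_enum. Qed.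

Lemma codom_perm k (w : 'I_k -> G) (s : {perm 'I_k}) :
  perm_eq (codom (w \o s)) (codom w).
Proof.
rewrite /codom /image_mem map_comp; apply: perm_map; apply: uniq_perm.
- by rewrite map_inj_uniq ?enum_uniq//; exact: perm_inj.
- exact: enum_uniq.
- move=> i; rewrite mem_enum; apply/mapP; exists (s^-1%g i); first by rewrite mem_enum.
  by rewrite permKV.
Qed.

Lemma codom_cons k (w : 'I_k.+1 -> G) :
  codom w = w ord0 :: codom (fun i => w (lift ord0 i)).
Proof. by rewrite /codom /image_mem enum_ordSl /= -map_comp. Qed.

Lemma list_form_symml k a : list_form a ->
  (fun w : 'I_k -> G => a (codom w)) \in @symml_pred R k G E.
Proof.
move=> [lina swa bnda]; apply/asboolP; split.
- by move=> w i c u v; have [s [t wE]] := codom_upd w i; rewrite !wE lina.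
- by move=> s w; apply: list_swap_perm => //; exact: codom_perm.
- have [M aM] := bnda k; exists M => w; rewrite -norm_prod_codom; apply: aM.
  by rewrite size_codom card_ord.
Qed.

Lemma list_form_cons a v : list_form a -> list_form (fun s => a (v :: s)).
Proof.
move=> [lina swa bnda]; split.
- by move=> s; exact: (lina (v :: s)).
- by move=> s; exact: (swa (v :: s)).
- move=> k; have [M aM] := bnda k.+1; exists (M * `|v|) => s sk.
  by rewrite -mulrA -norm_prod_cons aM.
Qed.

Lemma codom_nth k s : size s = k -> codom (fun i : 'I_k => nth 0 s i) = s.
Proof.
move=> sk; rewrite /codom /image_mem (map_comp (nth 0 s) (@nat_of_ord k)).
by rewrite val_enum_ord -sk -/(mkseq _ _) mkseq_nth.
Qed.

End list_forms.

Section evaluation.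
Context {R : realType} {G E : normedModType R}.

Lemma symml_le k (A : symml k G E) w : `|A w| <= `|A| * \prod_(i < k) `|w i|.
Proof.
have [w0|w0] := pselect (exists i, w i = 0).
  have [i wi] := w0.
  have -> : w = upd w i (0 *: w i).
    by apply/funext => j; rewrite /upd; case: eqP => [->|//]; rewrite scale0r.
  rewrite multilinearZ scale0r normr0 mulr_ge0// prodr_ge0 => //.
have {w0}wn0 i : `|w i| != 0.
  by rewrite normr_eq0; apply/eqP => wi; apply: w0; exists i.
have wE : w = (fun i => `|w i| *: (`|w i|^-1 *: w i)).
  by apply/funext => i; rewrite scalerA divff// scale1r.
rewrite {1}wE multilinearZs normrZ mulrC ger0_norm ?prodr_ge0//.
rewrite ler_wpM2r ?prodr_ge0//; apply: symml_norm_ub => i.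
by rewrite normrZ normfV normr_id mulVf.
Qed.

(** Reading a [k]-linear map on a list whose length need not be known to be [k]
avoids transporting along equalities of lengths; the value is meaningful when
the length is [k]. *)
Definition on_list k (A : symml k G E) (s : seq G) : E := A (fun i => nth 0 s i).

Lemma on_list_le k (A : symml k G E) s : size s = k ->
  `|on_list A s| <= `|A| * norm_prod s.
Proof.
move=> sk; apply: (le_trans (symml_le _ _)).
by rewrite /norm_prod (big_nth 0) big_mkord sk.
Qed.

Lemma on_list_codom k (A : symml k G E) w : on_list A (codom w) = A w.
Proof.
rewrite /on_list; congr (symml_val A _); apply/funext => i.
by rewrite /codom /image_mem (nth_map i) ?size_enum_ord// nth_ord_enum.
Qed.

Lemma symml_norm_bound k (A : symml k G E) M : 0 <= M ->
  (forall s, size s = k -> `|on_list A s| <= M * norm_prod s) -> `|A| <= M.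
Proof.
move=> M0 AM; apply: symml_norm_le => w w1; rewrite -on_list_codom.
rewrite (le_trans (AM _ _))// ?size_codom ?card_ord//.
rewrite norm_prod_codom -[leRHS]mulr1 ler_wpM2l// prodr_ile1// => i _.
by rewrite normr_ge0 w1.
Qed.

(** All the derivatives of [f] at [x] in one function: the order is the length of
the list. *)
Definition jet (f : G -> E) x s := on_list (frechet f (size s) x) s.

Lemma jetE f x k s : size s = k -> jet f x s = on_list (frechet f k x) s.
Proof. by move=> <-. Qed.

Lemma jet_form f x : list_form (jet f x).
Proof.
split.
- move=> s c u v t.
  have sz z : size (s ++ z :: t) = (size s + (size t).+1)%N by rewrite size_cat.
  rewrite !(jetE f x (sz _)) /on_list.
  set A := frechet _ _ _; have [mA _ _] := symmlP A.
  have ltst : (size s < size s + (size t).+1)%N by rewrite addnS ltnS leq_addr.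
  pose w := fun i : 'I_(size s + (size t).+1) => nth 0 (s ++ 0 :: t) i.
  have sE z : (fun i : 'I_(size s + (size t).+1) => nth 0 (s ++ z :: t) i) =
      upd w (Ordinal ltst) z.
    apply/funext => i; rewrite /upd /w -val_eqE /= !nth_cat.
    case: ltngtP => [//| si|->]; last by rewrite subnn.
    by case Ei: (i - size s)%N => //; move: si; rewrite -subn_gt0 Ei.
  by rewrite (sE (_ + _)) (sE u) (sE v) mA.
- move=> s u v t.
  have sz y z : size (s ++ y :: z :: t) = (size s + (size t).+2)%N.
    by rewrite size_cat.
  rewrite !(jetE f x (sz _ _)) /on_list.
  set A := frechet _ _ _; have [_ sA _] := symmlP A.
  have lt1 : (size s < size s + (size t).+2)%N by rewrite addnS ltnS leq_addr.
  have lt2 : ((size s).+1 < size s + (size t).+2)%N.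
    by rewrite !addnS !ltnS leq_addr.
  rewrite -(sA (tperm (Ordinal lt1) (Ordinal lt2))); congr (symml_val A _).
  apply/funext => i /=; rewrite !nth_cat.
  case: tpermP => [->|->|/eqP + /eqP +] /=.
  + by rewrite ltnn subnn ltnNge leqnSn /= subSn// subnn.
  + by rewrite ltnn subnn ltnNge leqnSn /= subSn// subnn.
  + rewrite -!val_eqE /=; case: ltngtP => // si _ si1.
    case Ei: (i - size s)%N => [|[|n]] //; first by move: si; rewrite -subn_gt0 Ei.
    by move: si1; rewrite -[nat_of_ord i](subnK (ltnW si)) Ei add1n eqxx.
- elim=> [|k [M IH]].
    exists `|frechet f 0 x| => s; rewrite leqn0 => /eqP s0.
    by rewrite (jetE f x s0) on_list_le.
  exists (M + `|frechet f k.+1 x|) => s; rewrite leq_eqVlt => /orP[/eqP sk|sk].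
    rewrite (jetE f x sk) (le_trans (on_list_le _ sk))// ler_wpM2r ?norm_prod_ge0//.
    by rewrite lerDr; have := IH [::] isT; rewrite /norm_prod big_nil mulr1;
      exact: le_trans.
  by rewrite (le_trans (IH s sk))// ler_wpM2r ?norm_prod_ge0// lerDl.
Qed.

(** Differentiability of all the derivatives of order at most [k], uniformly on
bounded lists: the derivative in the direction [v] prepends [v]. *)
Definition jet_step (k : nat) (a : G -> seq G -> E) (x : G) :=
  forall e, 0 < e -> \forall v \near (0 : G),
    bounded_upto k (e * `|v|) (fun s => a (x + v) s - a x s - a x (v :: s)).

Lemma smooth_jet_step X f k x : smooth_on X f -> X x -> jet_step k (jet f) x.
Proof.
move=> sf Xx e e0.
have step j : \forall v \near (0 : G), forall s, size s = j ->
    `|jet f (x + v) s - jet f x s - jet f x (v :: s)| <= e * `|v| * norm_prod s.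
  have [df st _] := sf j x Xx.
  have /diff_locally/eqaddoP/(_ e e0) := df.
  apply: filterS => v /= vle s sj.
  have -> : jet f x (v :: s) = on_list ('d (frechet f j) x v : symml j G E) s.
    rewrite (jetE f x (_ : size (v :: s) = j.+1)) ?[size _]/= ?sj//.
    by rewrite /on_list st.
  rewrite !(jetE f _ sj).
  have := @on_list_le _ (frechet f j (x + v) - frechet f j x -
      ('d (frechet f j) x v : symml j G E)) _ sj.
  move/le_trans; apply; rewrite ler_wpM2r ?norm_prod_ge0//.
  move: vle; rewrite !fctE /=.
  by rewrite opprD addrA (addrC v).
elim: k => [|k IH]; first by apply: filterS (step 0) => v H s;
  rewrite leqn0 => /eqP; exact: H.
apply: filterS2 IH (step k.+1) => v Hk H s.
by rewrite leq_eqVlt => /orP[/eqP|]; [exact: H|exact: Hk].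
Qed.

(** The way smoothness is proved below: it is enough to guess all the
derivatives at once, as symmetric multilinear functions on lists, and to check
the first-order expansions.  The differential of order [k] at [x] in the direction
[v] is then the map sending a list to the value at that list with [v]
prepended, and it is continuous because the bound of order [k.+1] is linear in
[|v|]. *)
Lemma smooth_of_jets X f (a : G -> seq G -> E) : open X ->
  (forall x, X x -> list_form (a x)) ->
  (forall x, X x -> a x [::] = f x) ->
  (forall k x, X x -> jet_step k a x) ->
  smooth_on X f /\ (forall k x s, X x -> size s = k ->
     on_list (frechet f k x) s = a x s).
Proof.
move=> oX aform a0 astep.
pose D k x : symml k G E := insubd 0 (fun w => a x (codom w)).
have DE k x w : X x -> D k x w = a x (codom w).
  move=> Xx; rewrite /D; rewrite -[LHS]/(val (insubd _ _) w) insubdK//.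
  by apply: list_form_symml; exact: aform.
have evD k x s : X x -> size s = k -> on_list (D k x) s = a x s.
  by move=> Xx sk; rewrite /on_list DE// codom_nth.
suff [sf fD] : smooth_on X f /\ (forall k x, X x -> frechet f k x = D k x).
  by split=> // k x s Xx sk; rewrite fD// evD.
apply: frechetP => // [x Xx|k x Xx].
  apply: symml_eqP => w; rewrite DE//= -a0//; congr (a x _).
  by apply: size0nil; rewrite size_codom card_ord.
have frm v : (fun w : 'I_k -> G => a x (v :: codom w)) \in @symml_pred R k G E.
  by apply: (@list_form_symml _ _ _ k (fun s => a x (v :: s)));
    apply: list_form_cons; exact: aform.
pose L v : symml k G E := Symml (frm v).
have [lina _ bnda] := aform x Xx.
have linL : linear L.
  move=> c u v; apply: symml_eqP => w; rewrite symmlZDE /=.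
  exact: (lina [::]).
pose L' : {linear G -> symml k G E} := HB.pack L
  (GRing.isLinear.Build _ _ _ _ L linL).
have [M aM] := bnda k.+1.
have M0 : 0 <= M.
  by have := aM [::] isT; rewrite /norm_prod big_nil mulr1; exact: le_trans.
have Lcont : continuous L'.
  apply/linear_bounded_continuous/linear_boundedP.
  exists M; split; first exact: num_real.
  move=> N MN v; rewrite (_ : `|L' v| = `|L v|)//.
  apply: symml_norm_bound; first by rewrite mulr_ge0// (le_trans M0)// ltW.
  move=> s sk; rewrite /on_list /=.
  rewrite codom_nth// (le_trans (aM _ _)) ?[size _]/= ?sk// norm_prod_cons mulrA.
  by rewrite ler_wpM2r ?norm_prod_ge0// ler_wpM2r// ltW.
have Lexp : D k \o shift x = cst (D k x) + L' +o_ 0 id.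
  apply/eqaddoP => e e0.
  have nX : \forall v \near (0 : G), X (x + v).
    have : (fun v => x + v) @ (0 : G) --> x.
      by rewrite -[X in _ --> X]addr0; apply: cvgD; [exact: cvg_cst|exact: cvg_id].
    by apply; exact: open_nbhs_nbhs.
  apply: filterS2 nX (astep k x Xx e e0) => v Xv H.
  rewrite (_ : `|_| = `|D k (x + v) - D k x - L v|); last first.
    by rewrite !fctE /= opprD addrA (addrC v).
  apply: symml_norm_bound; first by rewrite mulr_ge0// ltW.
  move=> s sk; rewrite (_ : on_list _ s = a (x + v) s - a x s - a x (v :: s)).
    by apply: H; rewrite sk.
  have <- : on_list (L v) s = a x (v :: s) by rewrite /on_list /= codom_nth.
  by rewrite -(evD k (x + v))// -(evD k x).
have dE : 'd (D k) x = L' :> (G -> symml k G E) by exact: diff_unique.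
split.
  apply/diff_locallyP; split; last by rewrite dE.
  by rewrite dE.
by move=> w; rewrite dE DE//= codom_cons.
Qed.

End evaluation.

(** * Leibniz' formula and smooth products *)

Lemma sub_telescope (V : zmodType) (a b c d e f : V) :
  a - b - (d + e) = a - c - f + (f - d) + (c - b - e).
Proof.
rewrite [a - c - f + _]addrA subrK (addrAC a (- c)) -(addrA c).
by rewrite [RHS]addrA subrK opprD addrACA.
Qed.

Section leibniz_formula.
Context {R : realType} {G E : normedModType R}.
Implicit Types (a : seq G -> R^o) (b : seq G -> E).

(** Leibniz' formula: each vector of [w] differentiates one of the two factors.
Unfolded, this is the sum over the subsets of the entries of [w], the entries in
the subset going to [a] and the others to [b]. *)
Fixpoint leibniz a b (w : seq G) : E :=
  if w is v :: w' then
    leibniz (fun s => a (v :: s)) b w' + leibniz a (fun s => b (v :: s)) w'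
  else (a [::] : R) *: b [::].

Lemma leibniz_linearl c a a' b w :
  leibniz (fun s => c *: a s + a' s) b w = c *: leibniz a b w + leibniz a' b w.
Proof.
elim: w a a' b => [|v w IH] a a' b /=; first by rewrite scalerDl scalerA.
by rewrite !IH scalerDr addrACA.
Qed.

Lemma leibniz_linearr c a b b' w :
  leibniz a (fun s => c *: b s + b' s) w = c *: leibniz a b w + leibniz a b' w.
Proof.
elim: w a b b' => [|v w IH] a b b' /=.
  by rewrite scalerDr !scalerA mulrC.
by rewrite !IH scalerDr addrACA.
Qed.

Lemma leibnizBl a a' b w :
  leibniz (fun s => a s - a' s) b w = leibniz a b w - leibniz a' b w.
Proof.
rewrite addrC -scaleN1r -leibniz_linearl; congr leibniz.
by apply/funext => s; rewrite scaleN1r addrC.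
Qed.

Lemma leibnizBr a b b' w :
  leibniz a (fun s => b s - b' s) w = leibniz a b w - leibniz a b' w.
Proof.
rewrite addrC -scaleN1r -leibniz_linearr; congr leibniz.
by apply/funext => s; rewrite scaleN1r addrC.
Qed.

Lemma bounded_upto_cons (V : normedModType R) k M (a : seq G -> V) v :
  bounded_upto k.+1 M a -> bounded_upto k (M * `|v|) (fun s => a (v :: s)).
Proof. by move=> aM s sk; rewrite -mulrA -norm_prod_cons aM. Qed.

Lemma bounded_uptoW (V : normedModType R) j k M (a : seq G -> V) :
  (j <= k)%N -> bounded_upto k M a -> bounded_upto j M a.
Proof. by move=> jk aM s sj; apply: aM; exact: leq_trans jk. Qed.

Lemma bounded_upto_ge0 (V : normedModType R) k M (a : seq G -> V) :
  bounded_upto k M a -> 0 <= M.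
Proof. by move=> /(_ [::] isT); rewrite /norm_prod big_nil mulr1; exact: le_trans. Qed.

(** The [2 ^+ k] terms of the unfolded formula each contribute the factor [P * Q]
and the norm of every entry exactly once. *)
Lemma leibniz_bound k a b P Q : bounded_upto k P a -> bounded_upto k Q b ->
  bounded_upto k (2 ^+ k * (P * Q)) (leibniz a b).
Proof.
move=> aP bQ w.
have P0 := bounded_upto_ge0 aP; have Q0 := bounded_upto_ge0 bQ.
elim: k w a b P Q aP bQ P0 Q0 => [|k IH] [|v w] // a b P Q aP bQ P0 Q0 wk /=.
- rewrite expr0 mul1r normrZ /norm_prod big_nil mulr1 ler_pM//.
    by have := aP [::] isT; rewrite /norm_prod big_nil mulr1.
  by have := bQ [::] isT; rewrite /norm_prod big_nil mulr1.
- rewrite normrZ /norm_prod big_nil mulr1 (@le_trans _ _ (P * Q))//.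
    by apply: ler_pM => //; [have := aP [::] isT|have := bQ [::] isT];
      rewrite /norm_prod big_nil mulr1.
  by rewrite ler_peMl ?mulr_ge0// exprn_ege1// ler1n.
- rewrite (le_trans (ler_normD _ _))//.
  have H1 := IH w _ _ _ _ (bounded_upto_cons v aP)
    (bounded_uptoW (leqnSn k) bQ) (mulr_ge0 P0 (normr_ge0 v)) Q0 wk.
  have H2 := IH w _ _ _ _ (bounded_uptoW (leqnSn k) aP)
    (bounded_upto_cons v bQ) P0 (mulr_ge0 Q0 (normr_ge0 v)) wk.
  apply: (le_trans (lerD H1 H2)); rewrite norm_prod_cons exprS.
  by rewrite le_eqVlt; apply/orP; left; apply/eqP; ring.
Qed.

Lemma leibniz_form a b : list_form a -> list_form b -> list_form (leibniz a b).
Proof.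
move=> [lina swa bnda] [linb swb bndb]; split.
- move=> s c u v t; elim: s a b lina {swa bnda} linb {swb bndb}
    => [|x s IH] a b lina linb /=.
    have -> : (fun s => a (c *: u + v :: s)) = (fun s => c *: a (u :: s) + a (v :: s)).
      by apply/funext => s; exact: (lina [::]).
    have -> : (fun s => b (c *: u + v :: s)) = (fun s => c *: b (u :: s) + b (v :: s)).
      by apply/funext => s; exact: (linb [::]).
    by rewrite leibniz_linearl leibniz_linearr scalerDr addrACA.
  rewrite (IH (fun s => a (x :: s)))//; last by move=> s0; exact: (lina (x :: s0)).
  rewrite (IH a (fun s => b (x :: s)))//; last by move=> s0; exact: (linb (x :: s0)).
  by rewrite scalerDr addrACA.
- move=> s u v t; elim: s a b {lina bnda} swa {linb bndb} swb
    => [|x s IH] a b swa swb /=.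
    have -> : (fun s => a (u :: v :: s)) = (fun s => a (v :: u :: s)).
      by apply/funext => s; exact: (swa [::]).
    have -> : (fun s => b (u :: v :: s)) = (fun s => b (v :: u :: s)).
      by apply/funext => s; exact: (swb [::]).
    by rewrite addrACA.
  rewrite (IH (fun s => a (x :: s)))//; last by move=> s0; exact: (swa (x :: s0)).
  by rewrite (IH a (fun s => b (x :: s)))// => s0; exact: (swb (x :: s0)).
- move=> k; have [P aP] := bnda k; have [Q bQ] := bndb k.
  by exists (2 ^+ k * (P * Q)); exact: leibniz_bound.
Qed.

(** The product rule: the increment of the product splits into the error of the
expansion of [a], the differential of [a] times the increment of [b], and the
error of the expansion of [b]; [sub_telescope] is this splitting. *)
Lemma leibniz_step k (a : G -> seq G -> R^o) (b : G -> seq G -> E) x :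
  list_form (a x) -> list_form (b x) ->
  jet_step k a x -> jet_step k b x ->
  jet_step k (fun y => leibniz (a y) (b y)) x.
Proof.
move=> [_ _ bnda] [_ _ bndb] da db e e0.
have [P aP] := bnda k.+1; have [Q bQ] := bndb k.+1.
have P0 := bounded_upto_ge0 aP; have Q0 := bounded_upto_ge0 bQ.
(* the three errors add up to at most C * d * |v| as soon as |v| <= d <= 1 *)
pose C := 2 ^+ k * (Q + 1 + Q + P * (Q + 1) + P).
have C0 : 0 <= C by rewrite mulr_ge0 ?exprn_ge0// ?addr_ge0// mulr_ge0// addr_ge0.
pose d := Num.min 1 (e / (C + 1)).
have d0 : 0 < d by rewrite lt_min ltr01 divr_gt0// ltr_wpDl.
have d1 : d <= 1 by rewrite ge_min lexx.
have dC : C * d <= e.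
  have : d <= e / (C + 1) by rewrite ge_min lexx orbT.
  rewrite ler_pdivlMr ?ltr_wpDl// mulrDr mulr1 => H.
  by rewrite mulrC (le_trans _ H)// lerDl ltW.
have nd : \forall v \near (0 : G), `|v| <= d.
  by have := @nbhs0_le _ G _ d0; apply: filterS.
apply: filterS3 nd (da d d0) (db d d0) => v vd Ha Hb.
pose av s := a x (v :: s); pose bv s := b x (v :: s).
have avP : bounded_upto k (P * `|v|) av by exact: bounded_upto_cons.
have bvQ : bounded_upto k (Q * `|v|) bv by exact: bounded_upto_cons.
have aPk := bounded_uptoW (leqnSn k) aP.
have bQk := bounded_uptoW (leqnSn k) bQ.
have b1b : bounded_upto k ((Q + 1) * `|v|) (fun s => b (x + v) s - b x s).
  move=> s sk; have := lerD (Hb s sk) (bvQ s sk).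
  rewrite -mulrDl -mulrDl => /(le_trans (ler_normD _ _)); rewrite subrK.
  move=> /le_trans; apply; rewrite ler_wpM2r ?norm_prod_ge0// ler_wpM2r//.
  by rewrite addrC lerD2l.
have b1 : bounded_upto k (Q + (Q + 1)) (b (x + v)).
  move=> s sk; rewrite -[b (x + v) s](subrK (b x s)) addrC mulrDl.
  rewrite (le_trans (ler_normD _ _))// lerD ?bQk// (le_trans (b1b s sk))//.
  rewrite ler_wpM2r ?norm_prod_ge0// ler_piMr ?addr_ge0//; exact: le_trans vd d1.
move=> w wk /=.
have -> : leibniz (a (x + v)) (b (x + v)) w - leibniz (a x) (b x) w -
   (leibniz av (b x) w + leibniz (a x) bv w) =
  leibniz (fun s => a (x + v) s - a x s - av s) (b (x + v)) w +
  leibniz av (fun s => b (x + v) s - b x s) w +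
  leibniz (a x) (fun s => b (x + v) s - b x s - bv s) w.
  rewrite (leibnizBl (fun s => a (x + v) s - a x s)) leibnizBl.
  rewrite (leibnizBr _ (fun s => b (x + v) s - b x s)) !leibnizBr.
  set A := leibniz (a (x + v)) (b (x + v)) w; set B := leibniz (a x) (b x) w.
  set C1 := leibniz av (b (x + v)) w; set C2 := leibniz av (b x) w.
  set C3 := leibniz (a x) bv w; set C4 := leibniz (a x) (b (x + v)) w.
  exact: sub_telescope.
have T1 := leibniz_bound Ha b1 wk.
have T2 := leibniz_bound avP b1b wk.
have T3 := leibniz_bound aPk Hb wk.
rewrite (le_trans (ler_normD _ _))// (le_trans (lerD (ler_normD _ _) (lexx _)))//.
rewrite (le_trans (lerD (lerD T1 T2) T3))// -!mulrDl ler_wpM2r ?norm_prod_ge0//.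
have : C * d * `|v| <= e * `|v| by rewrite ler_wpM2r.
apply: le_trans; rewrite /C.
have : 2 ^+ k * (P * `|v| * ((Q + 1) * `|v|)) <=
    2 ^+ k * (P * d * ((Q + 1) * `|v|)).
  rewrite ler_wpM2l ?exprn_ge0// ler_wpM2r ?mulr_ge0 ?addr_ge0//.
  by rewrite ler_wpM2l.
lra.
Qed.

Lemma smooth_on_mul X (g : G -> R^o) (f : G -> E) : open X ->
  smooth_on X g -> smooth_on X f ->
  smooth_on X (fun x => (g x : R) *: f x) /\
  (forall k x P Q, X x ->
    (forall j, (j <= k)%N -> `|frechet g j x| <= P) ->
    (forall j, (j <= k)%N -> `|frechet f j x| <= Q) ->
    forall j, (j <= k)%N ->
      `|frechet (fun x => (g x : R) *: f x) j x| <= 2 ^+ k * (P * Q)).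
Proof.
move=> oX sg sf.
have [|||smul mulE] := @smooth_of_jets R G E X (fun x => (g x : R) *: f x)
  (fun x => leibniz (jet g x) (jet f x)) oX.
- by move=> x _; apply: leibniz_form; exact: jet_form.
- by [].
- by move=> k x Xx; apply: leibniz_step;
    [exact: jet_form|exact: jet_form|exact: smooth_jet_step Xx..].
split=> // k x P Q Xx gP fQ j jk.
have jb (V : normedModType R) (h : G -> V) M :
    (forall j, (j <= k)%N -> `|frechet h j x| <= M) -> bounded_upto k M (jet h x).
  move=> hM s sk; rewrite (le_trans (on_list_le _ erefl))// ler_wpM2r ?norm_prod_ge0//.
  exact: hM.
have B := leibniz_bound (jb _ _ _ gP) (jb _ _ _ fQ).
apply: symml_norm_bound; first exact: bounded_upto_ge0 B.
by move=> s sj; rewrite mulE// B// sj.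
Qed.

(** Rescaling a bump function of width 1 by [l] multiplies its derivative of
order [k] by [l ^+ k]: this is where the cost [d^-n] of a narrow bump comes
from. *)
Lemma smooth_dilation X Z (f : G -> E) (z : G) (l : R) : open X -> open Z ->
  (forall x, X x -> Z (l *: (x - z))) -> smooth_on Z f ->
  smooth_on X (fun x => f (l *: (x - z))) /\
  (forall k x, X x ->
    `|frechet (fun x => f (l *: (x - z))) k x| <=
      `|l| ^+ k * `|frechet f k (l *: (x - z))|).
Proof.
move=> oX oZ XZ sf.
have [|||smul mulE] := @smooth_of_jets R G E X (fun x => f (l *: (x - z)))
  (fun x s => l ^+ (size s) *: jet f (l *: (x - z)) s) oX.
- move=> x _; have [lin sw bnd] := jet_form f (l *: (x - z)); split.
  + move=> s c u v t; rewrite lin !size_cat /= scalerDr !scalerA.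
    by rewrite (mulrC c).
  + by move=> s u v t; rewrite sw !size_cat.
  + move=> k; have [M fM] := bnd k.
    exists ((1 + `|l|) ^+ k * M) => s sk; rewrite normrZ -mulrA ler_pM//.
      rewrite normrX (@le_trans _ _ ((1 + `|l|) ^+ size s))//.
        by rewrite lerXn2r ?nnegrE ?addr_ge0// lerDr.
      by rewrite ler_weXn2l// lerDl.
    exact: fM.
- by move=> x _; rewrite expr0 scale1r.
- move=> k x Xx e e0.
  pose C := (1 + `|l|) ^+ k.+1.
  have C0 : 0 < C by rewrite exprn_gt0// ltr_pwDl.
  have stp := smooth_jet_step k sf (XZ x Xx) (divr_gt0 e0 C0).
  have lc : (fun v : G => l *: v) @ (0 : G) --> (0 : G).
    by rewrite -[X in _ --> X](scaler0 _ l); exact: scaler_continuous.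
  have : \forall v \near (0 : G), bounded_upto k (e / C * `|l *: v|) (fun s =>
      jet f (l *: (x - z) + l *: v) s - jet f (l *: (x - z)) s -
      jet f (l *: (x - z)) (l *: v :: s)) := lc _ stp.
  apply: filterS => v H s sk.
  have -> : l *: (x + v - z) = l *: (x - z) + l *: v.
    by rewrite -scalerDr addrAC.
  have -> : l ^+ (size s).+1 *: jet f (l *: (x - z)) (v :: s) =
      l ^+ size s *: jet f (l *: (x - z)) (l *: v :: s).
    have [lin _ _] := jet_form f (l *: (x - z)).
    have := lin [::] (-1) 0 0 s; rewrite /= scaler0 addr0 scaleN1r addNr => j0.
    have := lin [::] l v 0 s; rewrite /= addr0 j0 addr0 => ->.
    by rewrite exprSr scalerA.
  rewrite -!scalerBr normrZ normrX.
  rewrite (le_trans (ler_wpM2l _ (H s sk))) ?exprn_ge0//.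
  rewrite mulrA ler_wpM2r ?norm_prod_ge0// normrZ.
  rewrite (_ : _ * (_ * _) = `|l| ^+ (size s).+1 / C * (e * `|v|)); last first.
    by rewrite exprS; ring.
  rewrite ler_piMl ?mulr_ge0 ?(ltW e0)// ler_pdivrMr// mul1r /C.
  rewrite (@le_trans _ _ ((1 + `|l|) ^+ (size s).+1))//.
    by rewrite lerXn2r ?nnegrE ?addr_ge0// lerDr.
  by rewrite ler_weXn2l// lerDl.
split=> // k x Xx; apply: symml_norm_bound; first by rewrite mulr_ge0 ?exprn_ge0.
move=> s sk; rewrite mulE// normrZ normrX sk -mulrA ler_wpM2l ?exprn_ge0//.
by rewrite (jetE f _ sk) on_list_le.
Qed.

End leibniz_formula.

(** * Mean value and Taylor inequalities *)

Section mean_value.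
Context {R : realType}.

(** Only an upper bound on small increments is used, so that [u] may take
values in any normed space.  The parameters up to which the inequality with
slope [M + e] holds form an interval [0, c]; the local bound at its supremum [c]
extends the inequality to [c] and, if [c < b], beyond it. *)
Lemma mean_value_ineq (V : normedModType R) (u : R -> V) (M b : R) : 0 <= b ->
  (forall t, 0 <= t <= b -> forall e, 0 < e ->
    \forall h \near (0 : R), 0 <= t + h <= b ->
      `|u (t + h) - u t| <= (M + e) * `|h|) ->
  `|u b - u 0| <= M * b.
Proof.
move=> b0 du; suff H e : 0 < e -> `|u b - u 0| <= (M + e) * b.
  have [->|bn0] := eqVneq b 0; first by rewrite subrr normr0 mulr0.
  have bp : 0 < b by rewrite lt_neqAle eq_sym bn0.
  apply/ler_addgt0Pr => e e0; have := H (e / b) (divr_gt0 e0 bp).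
  by rewrite mulrDl divfK.
move=> e0; set C := M + e.
pose S := [set t | 0 <= t <= b /\ forall s, 0 <= s <= t -> `|u s - u 0| <= C * s].
have S0 : S 0.
  split; first by rewrite lexx.
  by move=> s; rewrite -eq_le => /eqP <-; rewrite subrr normr0 mulr0.
have hS : has_sup S.
  by split; [exists 0|exists b => t [/andP[]]].
set c := sup S.
have c0 : 0 <= c by apply: sup_upper_bound.
have cb : c <= b by apply: ge_sup; [case: hS|move=> t [/andP[]]].
have c0b : 0 <= c <= b by rewrite c0 cb.
have below s : 0 <= s -> s < c -> `|u s - u 0| <= C * s.
  move=> s0 sc; have sc0 : 0 < c - s by rewrite subr_gt0.
  have [t [_ tS]] := sup_adherent sc0 hS.
  rewrite -/c opprB addrC subrK => /ltW st; apply: tS; exact/andP.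
have [d d0 Hd] : exists2 d, 0 < d &
    forall h, `|h| < d -> 0 <= c + h <= b -> `|u (c + h) - u c| <= C * `|h|.
  have /nbhs_ballP[d /= d0 Hd] := du c c0b e e0.
  exists d => // h hd; apply: Hd; rewrite /ball/= sub0r normrN//.
have atc : `|u c - u 0| <= C * c.
  have [->|cn0] := eqVneq c 0; first by rewrite subrr normr0 mulr0.
  pose h := Num.min c (d / 2).
  have h0 : 0 < h by rewrite lt_min divr_gt0// lt_neqAle eq_sym cn0 c0.
  have hc : h <= c by rewrite ge_min lexx.
  have hd : h < d.
    by apply: (@le_lt_trans _ _ (d / 2)); [rewrite ge_min lexx orbT|lra].
  have H1 : `|u (c - h) - u 0| <= C * (c - h) by apply: below; lra.
  have H2 := Hd (- h); rewrite normrN gtr0_norm// in H2.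
  have {}H2 : `|u (c - h) - u c| <= C * h by apply: H2 => //; lra.
  rewrite distrC in H2.
  rewrite -[u c](subrK (u (c - h))) -addrA (le_trans (ler_normD _ _))//.
  by rewrite (le_trans (lerD H2 H1))// -mulrDr addrC subrK.
pose r := Num.min b (c + d / 2).
have rb : r <= b by rewrite ge_min lexx.
have rc : c <= r by rewrite le_min cb lerDl divr_ge0// ltW.
have Sr : S r.
  split; first by rewrite rb (le_trans c0 rc).
  move=> s /andP[s0 sr]; have [sc|cs] := ltP s c; first exact: below.
  have sd : s <= c + d / 2 by rewrite (le_trans sr)// ge_min lexx orbT.
  have sc0 : 0 <= s - c by rewrite subr_ge0.
  have := Hd (s - c); rewrite ger0_norm// [c + _]addrC subrK => H2.
  have {}H2 : `|u s - u c| <= C * (s - c) by apply: H2; lra.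
  rewrite -[u s](subrK (u c)) -addrA (le_trans (ler_normD _ _))//.
  by rewrite (le_trans (lerD H2 atc))// -mulrDr subrK.
have /le_anti rcE : r <= c <= r by rewrite rc andbT sup_upper_bound.
have : b <= c.
  rewrite -rcE le_min lexx /=; move: rcE; rewrite /r.
  by case: (leP b (c + d / 2)) => // _; lra.
move=> bc; have -> : b = c by apply/le_anti; rewrite bc cb.
exact: atc.
Qed.

End mean_value.

Section taylor.
Context {R : realType} {G E : normedModType R}.
Implicit Types (X : set G) (f : G -> E).

Lemma frechet_increment X f k x e : smooth_on X f -> X x -> 0 < e ->
  \forall v \near (0 : G),
    `|frechet f k (x + v) - frechet f k x| <= (`|frechet f k.+1 x| + e) * `|v|.
Proof.
move=> sf Xx e0; apply: filterS (smooth_jet_step k sf Xx e0) => v H.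
apply: symml_norm_bound.
  by rewrite mulr_ge0// addr_ge0// ltW.
move=> s sk; rewrite (_ : on_list _ s = jet f (x + v) s - jet f x s); last first.
  by rewrite !(jetE f _ sk).
rewrite -[X in `|X|](subrK (jet f x (v :: s))).
rewrite (le_trans (ler_normD _ _))// addrC mulrDl mulrDl lerD//; last first.
  by apply: H; rewrite sk.
rewrite (@jetE _ _ _ f x k.+1) ?[size _]/= ?sk//.
by rewrite (le_trans (on_list_le _ _)) ?[size _]/= ?sk// norm_prod_cons mulrA.
Qed.

Lemma frechet_eq0 X f k x : open X -> (forall y, X y -> f y = 0) -> X x ->
  frechet f k x = 0.
Proof.
move=> oX f0 Xx.
have [|//|_ H] := @frechetP R G E X f (fun k x => 0) oX.
- by move=> y Xy; rewrite f0//; exact: symml_eqP.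
- by move=> j y _; split; [exact: differentiable_cst|move=> w; rewrite diff_cst].
exact: H.
Qed.

(** Going down from the order [m], the mean value inequality on the segment
gains one factor [|v|] at each step because every derivative vanishes at its
origin. *)
Lemma flat_taylor X f m x v M : smooth_on X f ->
  (forall t, 0 <= t <= 1 -> X (x + t *: v)) ->
  (forall j, frechet f j x = 0) ->
  (forall t, 0 <= t <= 1 -> `|frechet f m (x + t *: v)| <= M) ->
  `|f (x + v)| <= M * `|v| ^+ m.
Proof.
move=> sf Xv f0 fM.
have M0 : 0 <= M by rewrite (le_trans _ (fM 0 _)) ?lexx ?ler01.
suff H i t : (i <= m)%N -> 0 <= t <= 1 ->
    `|frechet f (m - i) (x + t *: v)| <= M * `|v| ^+ i.
  have := H m 1 (leqnn m); rewrite subnn scale1r lexx ler01 => /(_ isT).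
  apply: le_trans.
  have := on_list_le (frechet f 0 (x + v)) (erefl (size [::])).
  by rewrite /norm_prod big_nil mulr1.
elim: i t => [|i IH] t im t01; first by rewrite subn0 expr0 mulr1 fM.
have /andP[t0 t1] := t01.
pose u s := frechet f (m - i.+1) (x + s *: v).
have mi : (m - i)%N = (m - i.+1).+1 by rewrite subnSK.
have u0 : u 0 = 0 by rewrite /u scale0r addr0 f0.
have := @mean_value_ineq R _ u (M * `|v| ^+ i.+1) t t0.
rewrite u0 subr0 => H.
apply: le_trans (H _) _; last first.
  by rewrite ler_piMr// mulr_ge0// exprn_ge0.
move=> s /andP[s0 st] e e0.
have s01 : 0 <= s <= 1 by rewrite s0 (le_trans st).
have e1 : 0 < e / (1 + `|v|) by rewrite divr_gt0// ltr_pwDl.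
have inc := frechet_increment (m - i.+1) sf (Xv s s01) e1.
have lc : (fun h : R => h *: v) @ (0 : R) --> (0 : G).
  by rewrite -[X in _ --> X](scale0r v); exact: scalel_continuous.
have : \forall h \near (0 : R),
  `|frechet f (m - i.+1) (x + s *: v + h *: v) -
    frechet f (m - i.+1) (x + s *: v)| <=
  (`|frechet f (m - i.+1).+1 (x + s *: v)| + e / (1 + `|v|)) * `|h *: v| := lc _ inc.
apply: filterS => h + _; rewrite -addrA -scalerDl => /le_trans; apply.
rewrite normrZ (mulrC `|h|) mulrA ler_wpM2r// mulrDl lerD//.
  by rewrite exprSr mulrA ler_wpM2r// -mi IH// ltnW.
by rewrite mulrAC ler_pdivrMr ?ltr_pwDl// ler_wpM2l ?ltW// ltrDr.
Qed.

End taylor.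

(** * Seminorms and neighbourhoods in the space of smooth functions *)

Section Cinf_basics.
Context {R : realType} {G : normedModType R} {X : set G} (oX : open X)
  {E : normedModType R}.
Implicit Types f g : Cinf oX E.

Lemma Cinf_smooth f : smooth_on X f.
Proof. by have /asboolP[] := Cinf_valP f. Qed.

Lemma Cinf_out f x : ~ X x -> f x = 0.
Proof. by have /asboolP[_] := Cinf_valP f; exact. Qed.

Lemma CinfZD c f g : (c *: f + g : Cinf oX E) = c *: (f : G -> E) + g :> (G -> E).
Proof. by []. Qed.

Lemma DnZD k c f g x : X x -> Dn k (c *: f + g) x = c *: Dn k f x + Dn k g x.
Proof.
move=> Xx; rewrite /Dn CinfZD.
by have [_ ->] := smooth_onZD c oX (Cinf_smooth f) (Cinf_smooth g).
Qed.

Lemma DnD k f g x : X x -> Dn k (f + g) x = Dn k f x + Dn k g x.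
Proof. by move=> Xx; rewrite -[f]scale1r DnZD// !scale1r. Qed.

Lemma DnB k f g x : X x -> Dn k (f - g) x = Dn k f x - Dn k g x.
Proof. by move=> Xx; rewrite addrC -scaleN1r DnZD// scaleN1r addrC. Qed.

Lemma DnZ k c f x : X x -> Dn k (c *: f) x = c *: Dn k f x.
Proof.
move=> Xx; have D0 : Dn k (0 : Cinf oX E) x = 0 by rewrite -(subrr f) DnB// subrr.
by rewrite -[c *: f]addr0 DnZD// D0 addr0.
Qed.

Lemma norm_Dn0 f x : `|f x| = `|Dn 0 f x|.
Proof.
apply/eqP; rewrite eq_le; apply/andP; split.
  have := on_list_le (Dn 0 f x) (erefl (size [::])).
  by rewrite /norm_prod big_nil mulr1.
apply: symml_norm_bound => // s /size0nil ->.
by rewrite /norm_prod big_nil mulr1.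
Qed.

Lemma Cinf_continuous f x : X x -> {for x, continuous f}.
Proof.
move=> Xx; have [_ _ fc] := Cinf_smooth f 0 Xx.
apply/cvgrPdist_le => e e0; move/cvgrPdist_le: fc => /(_ e e0).
apply: filterS => y; apply: le_trans.
have := on_list_le (frechet f 0 x - frechet f 0 y) (erefl (size [::])).
by rewrite /norm_prod big_nil mulr1.
Qed.

Lemma Dn_bounded (K : set G) k f : compact K -> K `<=` X ->
  exists2 M, 0 <= M & forall x j, K x -> (j <= k)%N -> `|Dn j f x| <= M.
Proof.
move=> cK KX.
have bnd j : exists2 M, 0 <= M & forall x, K x -> `|Dn j f x| <= M.
  have : compact (Dn j f @` K).
    apply: continuous_compact => //; apply: continuous_in_subspaceT => x.
    by rewrite inE => /KX Xx; have [] := Cinf_smooth f j Xx.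
  move/compact_bounded => [M [_ HM]]; exists (1 + `|M|); first by rewrite addr_ge0.
  move=> x Kx; apply: (HM (1 + `|M|)); last by exists x.
  by rewrite (le_lt_trans (ler_norm M))// ltrDr.
elim: k => [|k [M M0 IH]].
  have [M M0 HM] := bnd 0%N; exists M => // x j Kx.
  by rewrite leqn0 => /eqP ->; exact: HM.
have [N N0 HN] := bnd k.+1; exists (M + N); first exact: addr_ge0.
move=> x j Kx; rewrite leq_eqVlt => /orP[/eqP ->|jk].
  by rewrite (le_trans (HN x Kx))// lerDr.
by rewrite (le_trans (IH x j Kx jk))// lerDl.
Qed.

Lemma rho_ub K k f x j : compact K -> K `<=` X -> K x -> (j <= k)%N ->
  `|Dn j f x| <= rho K k f.
Proof.
move=> cK KX Kx jk; apply: sup_upper_bound; last by exists (j, x).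
have [M M0 HM] := Dn_bounded k f cK KX.
split; first by exists `|Dn j f x|, (j, x).
by exists M => _ [[i y] [/= ik Ky] <-]; exact: HM.
Qed.

Lemma rho_le K k f M : 0 <= M ->
  (forall x j, K x -> (j <= k)%N -> `|Dn j f x| <= M) -> rho K k f <= M.
Proof.
move=> M0 HM; rewrite /rho; set S := [set _ | _ in _].
have [->|S0] := eqVneq S set0; first by rewrite sup0.
apply: ge_sup; first exact/set0P.
by move=> _ [[j x] [/= jk Kx] <-]; exact: HM.
Qed.

Lemma rho_ball_open f K k e : compact K -> K `<=` X -> 0 < e ->
  open (rho_ball f K k e).
Proof.
move=> cK KX e0.
have B : @rho_balls R G X oX E (rho_ball f K k e) by exists f, K, k, e.
exists [set rho_ball f K k e].
  move=> _ ->; exists [fset (rho_ball f K k e)]%fset.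
    by move=> C; rewrite in_fset1 => /eqP CE; rewrite inE CE.
  apply/seteqP; split=> [g H|g H C /=]; first last.
    by rewrite in_fset1 => /eqP ->.
  by have := H (rho_ball f K k e); apply; rewrite /= in_fset1.
by rewrite bigcup_set1.
Qed.

(** Finitely many subbasic balls only involve a compact set and a finite order
of differentiation; each ball contains a smaller one centred at [f], by the
triangle inequality for its seminorm. *)
Lemma open_Cinf_nbhs (U : set (Cinf oX E)) f : open U -> U f ->
  exists K k e, [/\ compact K, K `<=` X, 0 < e & forall g,
    (forall x j, K x -> (j <= k)%N -> `|Dn j g x| <= e) -> U (f + g)].
Proof.
case=> D' D'sub <- [A D'A Af].
have [D Dsub AE] := D'sub _ D'A.
suff [K [k [e [cK KX e0 H]]]] : exists K k e,
  [/\ compact K, K `<=` X, 0 < e & forall g,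
    (forall x j, K x -> (j <= k)%N -> `|Dn j g x| <= e) -> A (f + g)].
  by exists K, k, e; split=> // g gK; exists A => //; exact: H.
have {}Dsub B : B \in D -> @rho_balls R G X oX E B by move=> /Dsub; rewrite inE.
have Df B : B \in D -> B f by move=> BD; rewrite -AE in Af; exact: Af.
suff fin : forall s : seq (set (Cinf oX E)),
   {subset s <= D} -> exists K k e, [/\ compact K, K `<=` X, 0 < e & forall g,
    (forall x j, K x -> (j <= k)%N -> `|Dn j g x| <= e) ->
    forall B, B \in s -> B (f + g)].
  have [//|K [k [e [cK KX e0 H]]]] := fin (enum_fset D).
  exists K, k, e; split=> // g gK; rewrite -AE => B /= BD; exact: H.
elim=> [|B s IH] sD.
  by exists set0, 0%N, 1; split=> //; exact: compact0.
have [|K [k [e [cK KX e0 H]]]] := IH.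
  by move=> C Cs; apply: sD; rewrite inE Cs orbT.
have BD : B \in D by apply: sD; rewrite mem_head.
have [f' [K' [k' [e' [cK' KX' e0' BE]]]]] := Dsub _ BD.
have := Df _ BD; rewrite BE /rho_ball /= => ff'.
pose d := (e' - rho K' k' (f - f')) / 2.
have d0 : 0 < d by rewrite divr_gt0// subr_gt0.
exists (K `|` K'), (maxn k k'), (Num.min e d); split=> //.
- exact: compactU.
- by move=> x [/KX|/KX'].
- by rewrite lt_min e0 d0.
move=> g gK C; rewrite inE => /orP[/eqP->|Cs]; last first.
  apply: H => // x j Kx jk; rewrite (le_trans (gK x j _ _))//; first by left.
    by rewrite leq_max jk.
  by rewrite ge_min lexx.
rewrite /=; apply: (@le_lt_trans _ _ (rho K' k' (f - f') + d)); last first.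
  by rewrite /d; lra.
have r0 : 0 <= rho K' k' (f - f').
  have [[x Kx]|K0] := pselect (K' !=set0).
    by rewrite (le_trans _ (@rho_ub K' k' _ x 0%N _ _ _ _)).
  rewrite /rho; set S := [set _ | _ in _].
  suff -> : S = set0 by rewrite sup0.
  by apply/seteqP; split=> // _ [[j x] [/= _ Kx] _]; apply: K0; exists x.
apply: rho_le; first by rewrite addr_ge0// ltW.
move=> x j Kx jk; rewrite addrAC DnD; last exact: KX'.
rewrite (le_trans (ler_normD _ _))// lerD ?rho_ub//.
rewrite (le_trans (gK x j _ _))//; first by right.
  by rewrite leq_max jk orbT.
by rewrite ge_min lexx orbT.
Qed.

End Cinf_basics.

Section estimate.
Context {R : realType} {G H E F : normedModType R} {X : set G} {Y : set H}
  (oX : open X) (oY : open Y).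
Variable T : {linear Cinf oX E -> Cinf oY F}.

(** The order [k] and the compact set [K] are independent of the order [m] and the
compact set [L] on the side of the target: all of the rigidity of [T] is in this
order of quantifiers. *)
Definition jet_bounded_by (K : set G) (k : nat) := forall (L : set H) (m : nat),
  compact L -> L `<=` Y -> exists2 C : R, 0 <= C &
  forall (g : Cinf oX E) (a : R), 0 < a ->
    (forall x j, K x -> (j <= k)%N -> `|Dn j g x| <= a) ->
    forall y, L y -> `|Dn m (T g) y| <= C * a.

(** A neighbourhood of [f] in [U] contains [f + g'] with [g'] a suitable multiple
of [g]; as the image of [U] is bounded, so is [T g' = T (f + g') - T f]. *)
Lemma bounded_open_estimate (U : set (Cinf oX E)) :
  open U -> U !=set0 -> tvs_bounded (T @` U) ->
  exists K k, [/\ compact K, K `<=` X & jet_bounded_by K k].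
Proof.
move=> oU [f Uf] bU.
have [K [k [e [cK KX e0 HU]]]] := open_Cinf_nbhs oU Uf.
exists K, k; split=> // L m cL LY.
have /bU : open (rho_ball (0 : Cinf oY F) L m 1) by exact: rho_ball_open.
case=> [|s s0 Hs].
  rewrite /rho_ball /= subr0 (le_lt_trans _ (@ltr01 R))// rho_le// => y j Ly _.
  by rewrite -[0 : Cinf oY F](scale0r 0) DnZ ?scale0r ?normr0//; exact: LY.
have s1 : s < s + 1 by rewrite ltrDl.
have sp : 0 < s + 1 by exact: lt_trans s1.
have TU g y : U g -> L y -> `|Dn m (T g) y| <= s + 1.
  move=> Ug Ly; have [|u + <-] := Hs _ s1 (T g); first by exists g.
  rewrite /rho_ball /= subr0 => u1.
  rewrite DnZ; last exact: LY.
  rewrite normrZ gtr0_norm// ler_piMr// ?(ltW sp)//.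
  by rewrite (le_trans _ (ltW u1))// rho_ub.
exists (((s + 1) *+ 2) / e); first by rewrite divr_ge0 ?mulrn_wge0// ltW.
move=> g a a0 ga y Ly; pose g' := (e / a) *: g.
have g'e x j : K x -> (j <= k)%N -> `|Dn j g' x| <= e.
  move=> Kx jk; rewrite DnZ; last exact: KX.
  rewrite normrZ gtr0_norm ?divr_gt0// mulrAC ler_pdivrMr// ler_wpM2l ?(ltW e0)//.
  exact: ga.
have := lerD (TU _ _ (HU _ g'e) Ly) (TU _ _ Uf Ly).
move=> /(le_trans (ler_normB _ _)); rewrite -DnB; last exact: LY.
rewrite -linearB /= [f + g']addrC addrK /g' linearZ /= DnZ; last exact: LY.
rewrite normrZ gtr0_norm ?divr_gt0// mulrAC ler_pdivrMr// => Hg.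
rewrite mulrAC ler_pdivlMr// mulrC.
by rewrite mulr2n.
Qed.

End estimate.

(** * Support points *)

Section cutoff.
Context {R : realType} {G E : normedModType R} {X : set G} (oX : open X).
Implicit Types (phi : Cinf (@openT G) R^o) (f : Cinf oX E).

Lemma cutoff_subproof phi z (l : R) f :
  (fun x => (phi (l *: (x - z)) : R) *: f x) \in @Cinf_pred R G E X.
Proof.
apply/asboolP; split=> [|x Xx]; last by rewrite (Cinf_out f Xx) scaler0.
have [sphi _] := @smooth_dilation R G R^o X setT phi z l oX openT
  (fun x _ => I) (Cinf_smooth phi).
by have [] := smooth_on_mul oX sphi (Cinf_smooth f).
Qed.

Definition cutoff phi z (l : R) f : Cinf oX E :=
  MkCinf oX (cutoff_subproof phi z l f).

Lemma cutoff_bound phi z l f k x P Q : X x ->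
  (forall j y, (j <= k)%N -> `|Dn j phi y| <= P) ->
  (forall j, (j <= k)%N -> `|Dn j f x| <= Q) ->
  forall j, (j <= k)%N ->
    `|Dn j (cutoff phi z l f) x| <= 2 ^+ k * ((1 + `|l|) ^+ k * P * Q).
Proof.
move=> Xx HP HQ.
have [sphi bphi] := @smooth_dilation R G R^o X setT phi z l oX openT
  (fun x _ => I) (Cinf_smooth phi).
have [_ bnd] := smooth_on_mul oX sphi (Cinf_smooth f).
have P0 : 0 <= P by rewrite (le_trans _ (HP 0%N 0 isT)).
apply: bnd => // j jk; rewrite (le_trans (bphi j x Xx))//.
apply: ler_pM; [exact: exprn_ge0|exact: normr_ge0| |exact: HP].
rewrite (@le_trans _ _ ((1 + `|l|) ^+ j))//.
  by rewrite lerXn2r ?nnegrE ?addr_ge0// lerDr.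
by rewrite ler_weXn2l// lerDl.
Qed.

Lemma bump_bounds phi : (forall k, exists M : R, forall x, `|Dn k phi x| <= M) ->
  forall k, exists2 P : R, 0 < P & forall j x, (j <= k)%N -> `|Dn j phi x| <= P.
Proof.
move=> bnd; have bnd' j : exists2 M : R, 0 < M & forall x, `|Dn j phi x| <= M.
  have [M HM] := bnd j; exists (1 + `|M|); first by rewrite ltr_pwDl.
  move=> x; rewrite (le_trans (HM x))// (le_trans (ler_norm M))//.
  by rewrite lerDr.
elim=> [|k [P P0 IH]].
  have [M M0 HM] := bnd' 0%N; exists M => // j x; rewrite leqn0 => /eqP ->.
  exact: HM.
have [N N0 HN] := bnd' k.+1; exists (P + N); first exact: addr_gt0.
move=> j x; rewrite leq_eqVlt => /orP[/eqP ->|jk].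
  by rewrite (le_trans (HN x))// lerDr ltW.
by rewrite (le_trans (IH j x jk))// lerDl ltW.
Qed.

End cutoff.

Section one_point_line.
Context {R : realType}.
Local Notation opc := (one_point_compactification R).

(** A closed interval stays closed after adding the point at infinity because it
is compact. *)
Lemma closed_Some_ball (a d : R) :
  closed (Some @` [set t : R | `|t - a| <= d] : set opc).
Proof.
have -> : [set t : R | `|t - a| <= d] = `[a - d, a + d]%classic.
  by apply/seteqP; split=> t /=; rewrite in_itv /= ler_distl.
have cl : closed `[a - d, a + d] by exact: interval_closed.
have co : compact `[a - d, a + d] by exact: segment_compact.
rewrite -openC openE => -[t|] Ht.
- have : nbhs t (~` `[a - d, a + d]).
    apply: open_nbhs_nbhs; split; first exact: closed_openC.
    by move=> ta; apply: Ht; exists t.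
  rewrite /interior; apply: filterS => s sa [r ra [rs]].
  by apply: sa; rewrite -rs.
- exists `[a - d, a + d]%classic; first by split.
  move=> p [[s sa <-] [r ra [rs]]|-> [] //].
  by apply: sa; rewrite -rs.
Qed.

Lemma open_Some_ball (a d : R) :
  open (Some @` [set t : R | `|t - a| < d] : set opc).
Proof.
apply: one_point_compactification_open_some.
have -> : [set t : R | `|t - a| < d] = `]a - d, a + d[%classic.
  by apply/seteqP; split=> t /=; rewrite in_itv /= ltr_distl.
exact: interval_open.
Qed.

End one_point_line.

Section embedding.
Context {R : realType} {G : normedModType R} {X : set G} (oX : open X).

Lemma evaluation_continuous (psi : Cinf oX R^o) :
  continuous (fun q : Rinf_pow oX => q psi).
Proof.
exact: (@proj_continuous (Cinf oX R^o) (fun=> one_point_compactification R) psi).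
Qed.

Lemma eval_embedding_continuous x : X x ->
  {for x, continuous (@eval_embedding R G X oX)}.
Proof.
move=> Xx; apply/cvg_sup => psi U [V [[W oW <-] Wx] /filterS]; apply.
have : Some @ (psi x : R) --> (Some (psi x : R) : one_point_compactification R).
  exact: one_point_compactification_some_continuous.
move=> /(_ W (open_nbhs_nbhs (conj oW Wx))) /= nW.
have := @Cinf_continuous _ _ _ _ _ psi x Xx _ nW.
exact.
Qed.

End embedding.

Section support.
Context {R : realType} {G H E F : normedModType R} {X : set G} {Y : set H}
  (oX : open X) (oY : open Y).
Variable T : {linear Cinf oX E -> Cinf oY F}.

(** The points of [X] at which [T f y] sees [f], described without the
compactification; [support_opens_bigcap] identifies them. *)
Definition supported_at (y : H) (x : G) := X x /\
  forall W : set G, open W -> W x ->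
    exists2 f : Cinf oX E, (forall z, ~ W z -> f z = 0) & T f y <> 0.

(** Some [f1] supported in [W] has [T f1 <> 0] at [y], hence near [y]; as [f1] and
[f] are disjoint, [T f] vanishes there. *)
Lemma supported_vanish y x (W : set G) (f : Cinf oX E) : separating T -> Y y ->
  supported_at y x -> open W -> W x -> (forall z, W z -> f z = 0) ->
  exists V : set H, [/\ open V, V y & forall z, V z -> T f z = 0].
Proof.
move=> sepT Yy [_ /(_ W)] /[apply] /[apply] -[f1 f10 Tf1] f0.
have /sepT dis : disjoint_funs f1 f.
  by move=> z _; have [Wz|Wz] := pselect (W z); [right; exact: f0|left; exact: f10].
have n0 : 0 < `|T f1 y| by rewrite normr_gt0; exact/eqP.
have /cvgrPdist_lt /(_ _ n0) := @Cinf_continuous _ _ _ _ _ (T f1) y Yy.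
rewrite nbhsE /= => -[V [oV Vy] HV].
exists (Y `&` V); split=> //; first exact: openI.
move=> z [Yz /HV Vz]; have [Tz|//] := dis z Yz.
by move: Vz; rewrite /= Tz subr0 ltxx.
Qed.

(** Otherwise each [x] in [K] has a ball such that [T f y = 0] for every [f]
supported in it.  Finitely many balls of half the radius cover [K]; subtracting
from [f] its products with the corresponding bumps one after the other kills
[f] near [K] without changing [T f y], and the estimate then gives [T f y = 0],
against the nontriviality of [T]. *)
Lemma supported_exists (K : set G) k : has_bump G -> nowhere_trivial T ->
  compact K -> K `<=` X -> jet_bounded_by T K k ->
  forall y, Y y -> exists2 x, K x & supported_at y x.
Proof.
move=> [phi [phi1 phi0 _]] ntT cK KX bT y Yy.
apply: contrapT => nsup.
have small x : K x -> exists2 r : R, 0 < r & forall f : Cinf oX E,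
    (forall z, r <= `|z - x| -> f z = 0) -> T f y = 0.
  move=> Kx; apply: contrapT => nr; apply: nsup; exists x => //; split.
    exact: KX.
  move=> W oW Wx; apply: contrapT => nf; apply: nr.
  have /nbhs_ballP[r /= r0 rW] : nbhs x W by exact: open_nbhs_nbhs.
  exists r => // f f0; apply: contrapT => Tf; apply: nf; exists f => // z Wz.
  apply: f0; rewrite leNgt; apply/negP => zr; apply: Wz; apply: rW.
  by rewrite -ball_normE /= distrC.
have {}small x : exists r : R, 0 < r /\ (K x -> forall f : Cinf oX E,
    (forall z, r <= `|z - x| -> f z = 0) -> T f y = 0).
  have [Kx|Kx] := pselect (K x); last by exists 1.
  by have [r r0 rf] := small x Kx; exists r.
have {small}[r rP] := choice small.
have r0 x : 0 < r x by have [] := rP x.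
have cov : K `<=` cover K (fun x => ball x (r x / 2)).
  by move=> x Kx; exists x => //; apply: ballxx; rewrite divr_gt0.
rewrite compact_cover in cK.
have [||D DK Dcov] := cK G K (fun x => ball x (r x / 2)).
- by move=> x _; exact: ball_open.
- exact: cov.
have kill (s : seq G) : (forall x, x \in s -> K x) -> forall f : Cinf oX E,
    exists2 g : Cinf oX E, T g y = T f y &
      forall x z, x \in s -> ball x (r x / 2) z -> g z = 0.
  elim: s => [_ f|x s IH sK f]; first by exists f.
  have [|g Tg g0] := IH _ f; first by move=> z zs; apply: sK; rewrite inE zs orbT.
  have Kx : K x by apply: sK; rewrite mem_head.
  exists (g - cutoff phi x (r x)^-1 g).
    have [_ /(_ Kx) cut0] := rP x.
    have TB (a b : Cinf oX E) : T (a - b) y = T a y - T b y by rewrite linearB.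
    rewrite -Tg TB (cut0 (cutoff phi x (r x)^-1 g)) ?subr0// => z rz.
    rewrite /= phi0 ?scale0r//.
    by rewrite normrZ gtr0_norm ?invr_gt0// mulrC ler_pdivlMr// mul1r.
  move=> x' z; rewrite inE.
  change ((x' == x) || (x' \in s) -> ball x' (r x' / 2) z ->
    g z - (phi ((r x)^-1 *: (z - x)) : R) *: g z = 0).
  move=> /orP[/eqP-> |x's] bz; last by rewrite (g0 _ _ x's bz) scaler0 subr0.
  rewrite phi1 ?scale1r ?subrr//.
  rewrite normrZ gtr0_norm ?invr_gt0// mulrC ler_pdivrMr// mulrC.
  by move: bz; rewrite -ball_normE /= distrC => /ltW.
have [f Tf] := ntT y Yy; apply: Tf.
have [|g <- g0] := kill D _ f; first by move=> x /DK; rewrite inE.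
pose V := \bigcup_(x in [set` D]) ball x (r x / 2).
have oV : open V by apply: bigcup_open => x _; exact: ball_open.
have gV x : V x -> g x = 0 by move=> [x' /= x'D bx]; exact: g0 bx.
have [|C C0 HC] := bT [set y] 0%N (@compact_set1 _ y); first by move=> _ ->.
apply/eqP; rewrite -normr_eq0 eq_le normr_ge0 andbT.
apply/ler_addgt0Pr => e e0; rewrite add0r norm_Dn0.
have a0 : 0 < e / (C + 1) by rewrite divr_gt0// ltr_wpDl.
apply: le_trans (HC g _ a0 _ y erefl) _.
  move=> x j Kx _; rewrite /Dn (frechet_eq0 j oV gV) ?normr0 ?ltW//.
  exact: Dcov.
by rewrite mulrCA ler_piMr ?(ltW e0)// ler_pdivrMr ?ltr_wpDl// mul1r lerDl.
Qed.

(** A point [p] other than the image of [x] is separated from it by some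
coordinate [psi].  Some [f] supported where [psi] is close to [psi x] has
[T f y <> 0], so one of the sets of [support_opens] has a closure that avoids
[p].  Conversely, if [T f y <> 0] then [f] cannot vanish near [x], by
[supported_vanish]. *)
Lemma support_opens_bigcap y x : separating T -> supported_at y x ->
  Y y ->
  \bigcap_(U in support_opens T y) closure U =
    [set @eval_embedding R G X oX x].
Proof.
move=> sepT sup Yy; have [Xx supx] := sup.
apply/seteqP; split=> [p Hp|_ -> U [[V oV ->] [f Tf fV]]].
- apply/funext => psi; rewrite /eval_embedding.
  apply: contrapT => pne.
  (* the witness 1 is arbitrary: there p psi is the point at infinity *)
  have [e e0 He] : exists2 e : R, 0 < e &
      forall t : R, p psi = Some t -> e < `|t - psi x|.
    case pp: (p psi) => [t|]; last by exists 1.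
    have tn : 0 < `|t - psi x|.
      rewrite normr_gt0 subr_eq0; apply/eqP => tE; apply: pne.
      by rewrite pp tE.
    exists (`|t - psi x| / 2); first by rewrite divr_gt0.
    by move=> _ [<-]; lra.
  pose J (d : R) : set (one_point_compactification R) :=
    Some @` [set t : R | `|t - psi x| <= d].
  pose I (d : R) : set (one_point_compactification R) :=
    Some @` [set t : R | `|t - psi x| < d].
  have cJ d : closed [set q : Rinf_pow oX | J d (q psi)].
    have /continuous_closedP evc := @evaluation_continuous _ _ _ oX psi.
    by apply: (evc (J d)); exact: closed_Some_ball.
  pose U : set (Rinf_pow oX) := [set q | I e (q psi)] `&` @compactification R G X oX.
  have UU : support_opens T y U.
    split.
      exists [set q | I e (q psi)] => //.
      have /continuousP evc := @evaluation_continuous _ _ _ oX psi.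
      by apply: (evc (I e)); exact: open_Some_ball.
    pose W : set G := X `&` [set z | `|psi x - psi z| < e / 2].
    have nW : nbhs x W.
      apply: filterI; first exact: open_nbhs_nbhs.
      have /cvgrPdist_lt := @Cinf_continuous _ _ _ _ _ psi x Xx.
      by apply; rewrite divr_gt0.
    have [f f0 Tf] := supx _ (open_interior W) nW.
    exists f => //.
    have sub : closed_carrier f `<=` [set q | J (e / 2) (q psi)].
      rewrite /closed_carrier closureE; apply: smallest_sub => //.
      move=> _ [z [Xz fz] <-]; exists (psi z) => //=.
      rewrite distrC; apply: contrapT => nz; apply: fz; apply: f0.
      by move=> /interior_subset [_ /= /ltW].
    move=> q qf; split.
      by have [t /= te <-] := sub q qf; exists t => //=; lra.
    by apply: closure_subset qf; apply: image_subset => z [].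
  have : [set q : Rinf_pow oX | J e (q psi)] p.
    have := Hp U UU; rewrite closureE; apply; split=> //.
    by move=> q [[t /= /ltW te <-] _]; exists t.
  by case=> t /= te /esym /He; rewrite ltNge te.
- apply: subset_closure; apply: fV => B nB.
  have nW : nbhs x (X `&` (@eval_embedding R G X oX @^-1` B)).
    by apply: filterI; [exact: open_nbhs_nbhs|exact: eval_embedding_continuous].
  apply: contrapT => dis; apply: Tf.
  have [|V' [_ V'y TV']] := @supported_vanish y x _ f sepT Yy sup
    (open_interior _) nW; last exact: TV'.
  move=> z /interior_subset [Xz Bz]; apply: contrapT => fz; apply: dis.
  by exists (eval_embedding z); split=> //; exists z.
Qed.

Lemma support_mapE y y' x : separating T -> Y y -> Y y' ->
  supported_at y x -> supported_at y' x -> support_map T y = support_map T y'.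
Proof.
move=> sepT Yy Yy' sx sx'; rewrite /support_map.
by rewrite (support_opens_bigcap sepT sx Yy) (support_opens_bigcap sepT sx' Yy').
Qed.

End support.

(** * Rigidity of the support map *)

Lemma square_increment_const (R : realType) (V : normedModType R) (h : R -> V) B :
  0 <= B ->
  (forall s t, 0 <= s <= 1 -> 0 <= t <= 1 -> `|h s - h t| <= B * `|s - t| ^+ 2) ->
  h 1 = h 0.
Proof.
move=> B0 hB; suff : `|h 1 - h 0| <= 0 * 1.
  by rewrite mul0r normr_le0 subr_eq0 => /eqP.
apply: (@mean_value_ineq R V h 0 1 ler01) => t t01 e e0.
have d0 : 0 < e / (B + 1) by rewrite divr_gt0// ltr_wpDl.
apply: filterS (@nbhs0_le _ R^o _ d0) => k /= kd tk01.
rewrite (le_trans (hB _ _ tk01 t01))// [t + k]addrC addrK expr2 mulrA add0r.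
rewrite ler_wpM2r//; move: kd; rewrite ler_pdivlMr ?ltr_wpDl//.
by apply: le_trans; rewrite mulrC ler_wpM2l// lerDl.
Qed.

Section rigidity.
Context {R : realType} {G H E F : normedModType R} {X : set G} {Y : set H}
  (oX : open X) (oY : open Y).
Variable T : {linear Cinf oX E -> Cinf oY F}.

Lemma jet_bounded_byW (K : set G) j k : (j <= k)%N ->
  jet_bounded_by T K j -> jet_bounded_by T K k.
Proof.
move=> jk bT L m cL LY; have [C C0 HC] := bT L m cL LY.
exists C => // g a a0 ga; apply: HC => // x i Kx ij.
by apply: ga => //; exact: leq_trans ij jk.
Qed.

(** With [d = |x - x'|], the product of [f] with a bump of radius [d / 2] around [x']
has the same image as [f] at the second point, and a flat image at the first.  Taylor's
inequality of order [2 * k.+1] beats the cost [d ^- k.+1] of the bump by the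
square of [|s - t|]. *)
Lemma support_square_increment (K : set G) k (f : Cinf oX E) y v (c : R) :
  has_bump G -> separating T -> compact K -> K `<=` X -> jet_bounded_by T K k ->
  (forall t, 0 <= t <= 1 -> Y (y + t *: v)) ->
  0 < c -> (forall t, 0 <= t <= 1 -> c <= `|T f (y + t *: v)|) ->
  exists2 B : R, 0 <= B & forall s t x x', 0 <= s <= 1 -> 0 <= t <= 1 ->
    K x -> K x' -> supported_at T (y + s *: v) x ->
    supported_at T (y + t *: v) x' -> `|x - x'| <= B * `|s - t| ^+ 2.
Proof.
move=> [phi [phi1 phi0 bphi]] sepT cK KX bT0 Yv c0 fc.
(* n > 0 is needed to take n-th roots at the end *)
pose n := k.+1; have bT := jet_bounded_byW (leqnSn k) bT0.
pose L : set H := [set y + t *: v | t in `[0, 1]%classic].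
have cL : compact L.
  apply: continuous_compact; last exact: segment_compact.
  apply: continuous_subspaceT => t; apply: cvgD; first exact: cvg_cst.
  exact: scalel_continuous.
have LY : L `<=` Y by move=> _ [t /= t01 <-]; apply: Yv; rewrite in_itv/= in t01.
have [C C0 HC] := bT L (2 * n)%N cL LY.
have [P P0 HP] := bump_bounds bphi n.
have [Q Q0 HQ] := Dn_bounded n f cK KX.
have [N N0 HN] : exists2 N : R, 0 <= N & forall x, K x -> `|x| <= N.
  have [M [_ HM]] := compact_bounded cK; exists (1 + `|M|).
    by rewrite addr_ge0.
  move=> x Kx; apply: (HM (1 + `|M|)) => //.
  by rewrite (le_lt_trans (ler_norm M))// ltrDr.
pose S := C * 2 ^+ n * P * (Q + 1) * `|v| ^+ (2 * n).
pose A := S * (2 * N + 2) ^+ n / c.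
have S0 : 0 <= S by rewrite !mulr_ge0 ?exprn_ge0 ?addr_ge0// ltW.
have A0 : 0 <= A.
  by rewrite divr_ge0 ?(ltW c0)// mulr_ge0// exprn_ge0// addr_ge0// mulr_ge0.
exists (A + 1); first by rewrite addr_ge0.
move=> s t x x' s01 t01 Kx Kx' sx sx'.
set d := `|x - x'|.
have [->|dn0] := eqVneq d 0; first by rewrite mulr_ge0 ?addr_ge0 ?exprn_ge0.
have d0 : 0 < d by rewrite lt_neqAle eq_sym dn0 normr_ge0.
have dN : d <= 2 * N.
  by rewrite (le_trans (ler_normB _ _))// mulr_natl mulr2n lerD ?HN.
have d2 : 0 < 2 / d by rewrite divr_gt0.
pose g := cutoff phi x' (2 / d) f.
pose a := 2 ^+ n * ((1 + `|2 / d|) ^+ n * P * (Q + 1)).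
have a0 : 0 < a.
  have l0 : 0 < 1 + `|2 / d| by rewrite ltr_pwDl.
  have Q1 : 0 < Q + 1 by rewrite ltr_wpDl.
  by rewrite !mulr_gt0// exprn_gt0.
have ga z j : K z -> (j <= n)%N -> `|Dn j g z| <= a.
  move=> Kz; apply: cutoff_bound => //; first exact: KX.
  by move=> i im; rewrite (le_trans (HQ z i Kz im))// lerDl.
(* g vanishes on the ball of radius d / 2 around x *)
have flat j : frechet (T g) j (y + s *: v) = 0.
  have [|V [oV Vs TV]] := @supported_vanish _ _ _ _ _ _ _ _ _ T
    _ _ (ball x (d / 2)) g sepT (Yv s s01) sx (ball_open _ _)
    (ballxx _ (divr_gt0 d0 (ltr0Sn _ 1))).
    move=> z; rewrite -ball_normE /= => xz; rewrite phi0 ?scale0r//.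
    rewrite normrZ gtr0_norm// mulrAC ler_pdivlMr// mul1r.
    have := ler_distD z x x'; rewrite -/d; lra.
  exact: (frechet_eq0 j oV TV Vs).
(* g = f on the ball of radius d / 4 around x' *)
have Tgf : T g (y + t *: v) = T f (y + t *: v).
  have [|V [_ Vt TV]] := @supported_vanish _ _ _ _ _ _ _ _ _ T
    _ _ (ball x' (d / 4)) (f - g) sepT (Yv t t01) sx' (ball_open _ _)
    (ballxx _ (divr_gt0 d0 (ltr0Sn _ 3))).
    move=> z; rewrite -ball_normE /= distrC => xz.
    change (f z - (phi ((2 / d) *: (z - x')) : R) *: f z = 0).
    rewrite phi1 ?scale1r ?subrr//.
    rewrite normrZ gtr0_norm// mulrAC ler_pdivrMr//; lra.
  have := TV _ Vt; rewrite linearB => /eqP.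
  by rewrite [X in X == 0](_ : _ = T f (y + t *: v) - T g (y + t *: v))//
    subr_eq0 => /eqP.
have st r : 0 <= r <= 1 -> 0 <= s + r * (t - s) <= 1.
  by move: s01 t01 => /andP[? ?] /andP[? ?] /andP[? ?]; nra.
have lineE r : y + s *: v + r *: ((t - s) *: v) = y + (s + r * (t - s)) *: v.
  by rewrite scalerA -addrA -scalerDl.
have main : c <= C * a * `|(t - s) *: v| ^+ (2 * n).
  rewrite (le_trans (fc t t01))// -Tgf.
  have -> : y + t *: v = y + s *: v + (t - s) *: v.
    by rewrite -addrA -scalerDl [s + _]addrC subrK.
  apply: (flat_taylor (Cinf_smooth (T g))) flat _ => r r01; rewrite lineE.
    by apply: Yv; exact: st.
  by apply: HC => //; exists (s + r * (t - s)); rewrite //= in_itv /= st.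
(* multiplying by d ^+ n absorbs the cost (1 + 2 / d) ^+ n of the bump into
   (d + 2) ^+ n, which the diameter of K controls *)
have dnS : d ^+ n * c <= S * (2 * N + 2) ^+ n * (`|s - t| ^+ 2) ^+ n.
  apply: (@le_trans _ _ (d ^+ n * (C * a * `|(t - s) *: v| ^+ (2 * n)))).
    by rewrite ler_wpM2l// exprn_ge0// ltW.
  have -> : d ^+ n * (C * a * `|(t - s) *: v| ^+ (2 * n)) =
      S * (d + 2) ^+ n * (`|s - t| ^+ 2) ^+ n.
    have <- : d ^+ n * (1 + `|2 / d|) ^+ n = (d + 2) ^+ n.
      by rewrite -exprMn gtr0_norm// mulrDr mulr1 mulrCA divff// mulr1.
    rewrite normrZ exprMn (distrC t) -exprM /a /S; ring.
  rewrite ler_wpM2r ?exprn_ge0// ler_wpM2l// lerXn2r ?nnegrE ?addr_ge0 ?mulr_ge0//.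
  - exact: ltW.
  - by rewrite lerD2r.
rewrite -(@ler_pXn2r _ n)// ?nnegrE ?(ltW d0) ?mulr_ge0 ?addr_ge0 ?exprn_ge0//.
rewrite exprMn; apply: (@le_trans _ _ (A * (`|s - t| ^+ 2) ^+ n)).
  by rewrite /A mulrAC ler_pdivlMr.
rewrite ler_wpM2r ?exprn_ge0// (@le_trans _ _ (A + 1))// ?lerDl//.
by rewrite -[leLHS]expr1 ler_weXn2l// lerDr.
Qed.

(** [T f] is bounded below on a small ball around [y], and every other point of the
ball is joined to [y] by a segment inside it. *)
Lemma support_locally_constant (K : set G) k :
  has_bump G -> separating T -> nowhere_trivial T ->
  compact K -> K `<=` X -> jet_bounded_by T K k ->
  forall y, Y y -> \forall z \near y, Y z /\ support_map T y = support_map T z.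
Proof.
move=> bump sepT ntT cK KX bT y Yy.
have hP z : exists x, Y z -> K x /\ supported_at T z x.
  have [Yz|Yz] := pselect (Y z); last by exists 0.
  by have [x Kx sx] := supported_exists bump ntT cK KX bT Yz; exists x.
have {hP}[h hP] := choice hP.
have [f Tf] := ntT y Yy.
have n0 : 0 < `|T f y| / 2 by rewrite divr_gt0// normr_gt0; exact/eqP.
have /cvgrPdist_lt /(_ _ n0) nf := @Cinf_continuous _ _ _ _ _ (T f) y Yy.
have /nbhs_ballP[r /= r0 rP] :
    nbhs y (Y `&` [set z | `|T f y - T f z| < `|T f y| / 2]).
  by apply: filterI => //; exact: open_nbhs_nbhs.
apply/nbhs_ballP; exists r => //= z yz; split; first by have [] := rP z yz.
have seg t : 0 <= t <= 1 -> ball y r (y + t *: (z - y)).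
  move=> /andP[t0 t1]; move: yz; rewrite -!ball_normE /= => yz.
  rewrite opprD addrA subrr sub0r normrN normrZ ger0_norm// distrC.
  by rewrite (le_lt_trans _ yz)// ler_piMl.
have Yseg t : 0 <= t <= 1 -> Y (y + t *: (z - y)) by move=> /seg/rP[].
have fseg t : 0 <= t <= 1 -> `|T f y| / 2 <= `|T f (y + t *: (z - y))|.
  move=> /seg/rP[_ /=] => H1.
  have := lerB_dist (T f y) (T f (y + t *: (z - y))); lra.
have [B B0 HB] := support_square_increment bump sepT cK KX bT Yseg n0 fseg.
have := @square_increment_const R G (fun t => h (y + t *: (z - y))) B B0.
rewrite scale1r scale0r addr0 [y + _]addrC subrK => hzy.
have {}hzy : h z = h y.
  apply: hzy => s t s01 t01; have [Ks ss] := hP _ (Yseg s s01).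
  by have [Kt stt] := hP _ (Yseg t t01); exact: HB.
have Yz : Y z by have [] := rP z yz.
apply: (support_mapE sepT Yy Yz) (proj2 (hP y Yy)) _.
by rewrite -hzy; exact: (proj2 (hP z Yz)).
Qed.

End rigidity.

(** The fibres of a locally constant function are open, and so is the
complement of each, being a union of fibres. *)
Lemma locally_constant_partition (U : topologicalType) (V : Type) (Y : set U)
    (h : U -> V) : open Y ->
  (forall y, Y y -> \forall z \near y, h y = h z) ->
  exists (I : Type) (Ya : I -> set U),
    [/\ partition [set: I] Ya Y,
        forall a, @clopen (subspace Y) (Ya a) &
        forall a y y', Ya a y -> Ya a y' -> h y = h y'].
Proof.
move=> oY hloc.
(* only the values attained on Y are indices, so that no block is empty *)
exists {v : V | exists2 y, Y y & h y = v}, (fun a => [set y | Y y /\ h y = sval a]).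
have opn (Q : V -> Prop) : open (Y `&` [set y | Q (h y)]).
  rewrite openE => y [Yy Qy]; rewrite /interior.
  apply: filterS2 (open_nbhs_nbhs (conj oY Yy)) (hloc y Yy) => z Yz hz.
  by split=> //=; rewrite -hz.
split.
- split.
  + apply/seteqP; split=> [y [a _ []//]|y Yy].
    have hy : exists2 z, Y z & h z = h y by exists y.
    by exists (exist _ (h y) hy).
  + move=> [v vP] [w wP] _ _ [y [/= [_ yv] [_ yw]]].
    have {yv yw}vw : v = w by rewrite -yv.
    by subst w; rewrite (Prop_irrelevance vP wP).
  + by move=> [v [y Yy hy]] _; exists y.
- move=> [v vP] /=; split.
    by apply: open_subspaceW; exact: (opn (fun w => w = v)).
  rewrite -openC; apply/open_subspaceP.
  exists (Y `&` [set y | h y <> v]); first exact: (opn (fun w => w <> v)).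
  apply/seteqP; split=> z /= [].
    by move=> [Yz hz] _; split=> // -[].
  by move=> nz Yz; split=> //; split=> // hz; apply: nz.
- by move=> a y y' [_ ->] [_ ->].
Qed.

Theorem theorem18 (R : realType) (G H E F : completeNormedModType R)
    (X : set G) (Y : set H) (oX : open X) (oY : open Y)
    (bump : has_bump G)
    (T : {linear Cinf oX E -> Cinf oY F})
    (sepT : separating T) (ntT : nowhere_trivial T)
    (bddT : exists U : set (Cinf oX E),
       [/\ open U, U !=set0 & tvs_bounded (T @` U)]) :
  exists (I : Type) (Ya : I -> set H),
    [/\ partition [set: I] Ya Y,
        forall a, @clopen (subspace Y) (Ya a) &
        forall a y y', Ya a y -> Ya a y' ->
          support_map T y = support_map T y'].
Proof.
have [U [oU U0 bU]] := bddT.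
have [K [k [cK KX bT]]] := bounded_open_estimate oU U0 bU.
apply: locally_constant_partition => // y Yy.
by apply: filterS (support_locally_constant bump sepT ntT cK KX bT Yy) => z [].
Qed.
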